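(* Let $\bar{x} \in \Omega$ be a feasible solution of (CTP). Assume that (H1) and (H2) are satisfied at $\bar{x}$ and that AKKT-regularity is satisfied at $\bar{x}$. If $\bar{x}$ is a local optimal solution of (CTP), then $\bar{x}$ is a KKT solution of (CTP).
   Context: Problem. Let $T>0$, and let $\phi:\mathbb{R}^n\times[0,T]\to\mathbb{R}$, $h=(h_1,\dots,h_p):\mathbb{R}^n\times[0,T]\to\mathbb{R}^p$, $g=(g_1,\dots,g_m):\mathbb{R}^n\times[0,T]\to\mathbb{R}^m$ be given; $I=\{1,\dots,p\}$, $J=\{1,\dots,m\}$. Problem (CTP): minimize $P(x)=\int_0^T\phi(x(t),t)\,dt$ over $x\in L^\infty([0,T];\mathbb{R}^n)$ subject to $h(x(t),t)=0$ and $g(x(t),t)\le 0$ for a.e. $t\in[0,T]$ (vector inequalities are componentwise, integrals are Lebesgue integrals). The feasible set is $\Omega=\{x\in L^\infty([0,T];\mathbb{R}^n): h(x(t),t)=0,\ g(x(t),t)\le 0 \text{ for a.e. } t\in[0,T]\}$. For a given $\bar{x}\in\Omega$ and $r>0$, $B_r(t)=\{x\in\mathbb{R}^n:\|x-\bar{x}(t)\|<r\}$ and $\bar{B}_r(t)=\{x\in\mathbb{R}^n:\|x-\bar{x}(t)\|\le r\}$, for a.e. $t$. Local optimality. $\bar{x}\in\Omega$ is a local optimal solution if there exists a radius $r'>0$ such that $P(\bar{x})\le P(x)$ for every $x\in\Omega$ with $x(t)\in B_{r'}(t)$ for a.e. $t\in[0,T]$. Assumptions. (H1) and (H2) are satisfied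 at $\bar{x}\in\Omega$ if there is $r>0$ (fixed from now on) such that: (H1) $\phi(\cdot,t)$ is continuously differentiable for a.e. $t\in[0,T]$; $\phi(x,\cdot)$ is Lebesgue measurable for each $x$; $|\phi(\bar{x}(\cdot),\cdot)|$ is integrable on $[0,T]$; there are integrable functions $c_\phi,\hat{c}_\phi$ on $[0,T]$ with $|\phi(x,t)-\phi(y,t)|\le c_\phi(t)\|x-y\|$ for all $x,y\in\bar{B}_r(t)$ and $\|\nabla_x\phi(x,t)\|\le\hat{c}_\phi(t)$ for all $x\in\bar{B}_r(t)$, for a.e. $t\in[0,T]$. (H2) $(h,g)(\cdot,t)$ is continuously differentiable for a.e. $t\in[0,T]$; $(h,g)(x,\cdot)$ is Lebesgue measurable for each $x$; $\|(h,g)(\bar{x}(\cdot),\cdot)\|$ is integrable on $[0,T]$; there are integrable functions $c_{h,g},\hat{c}_{h,g}$ on $[0,T]$ with $\|(h,g)(x,t)-(h,g)(y,t)\|\le c_{h,g}(t)\|x-y\|$ for all $x,y\in\bar{B}_r(t)$ and $\|\nabla_x(h,g)(x,t)\|\le\hat{c}_{h,g}(t)$ for all $x\in\bar{B}_r(t)$, for a.e. $t\in[0,T]$. KKT solution. $\bar{x}\in\Omega$ (with (H1), (H2)) is a KKT solution of (CTP) if there exist $u\in L^\infty([0,T];\mathbb{R}^p)$ and $v\in L^\infty([0,T];\mathbb{R}^m)$ such that for a.e. $t\in[0,T]$: $\nabla_x\phi(\bar{x}(t),t)+\sum_{i=1}^p u_i(t)\nabla_xh_i(\bar{x}(t),t)+\sum_{j=1}^m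 v_j(t)\nabla_xg_j(\bar{x}(t),t)=0$, and $v_j(t)g_j(\bar{x}(t),t)=0$, $v_j(t)\ge 0$ for all $j\in J$. AKKT-regularity. Let $g_j^-(x,t)=\max\{-g_j(x,t),0\}$, $E=\{x\in L^\infty([0,T];\mathbb{R}^n): x(t)\in B_r(t)\text{ a.e. }t\in[0,T]\}$, $F=\{\theta\in L^1([0,T];\mathbb{R}^m):\theta(t)\ge 0\text{ a.e. }t\in[0,T]\}$. For $(x,\theta)\in E\times F$, $\mathcal{M}(x,\theta)$ is the set of all $\psi\in L^1([0,T];\mathbb{R}^n)$ for which there is $(u,v)\in L^\infty([0,T];\mathbb{R}^p\times\mathbb{R}^m)$ such that, for a.e. $t\in[0,T]$, $\psi(t)=\sum_{i=1}^p u_i(t)\nabla_xh_i(x(t),t)+\sum_{j=1}^m v_j(t)\nabla_xg_j(x(t),t)$, $v_j(t)g_j^-(x(t),t)=\theta_j(t)$ and $v_j(t)\ge0$ for all $j\in J$. The weak outer limit $\mathrm{w}\text{-}\limsup_{(x,\theta)\to(\bar{x},0)}\mathcal{M}(x,\theta)$ is the set of all $\psi\in L^1([0,T];\mathbb{R}^n)$ for which there exist $\{(x^k,\theta^k)\}\subset E\times F$ with $(x^k(t),\theta^k(t))\to(\bar{x}(t),0)$ for a.e. $t\in[0,T]$ and $\psi^k\in\mathcal{M}(x^k,\theta^k)$ for all $k\in\mathbb{N}$ with $\psi^k\rightharpoonup\psi$ weakly in $L^1([0,T];\mathbb{R}^n)$. AKKT-regularity is satisfied at $\bar{x}$ if $\mathrm{w}\text{-}\limsup_{(x,\theta)\to(\bar{x},0)}\mathcal{M}(x,\theta)\subset\mathcal{M}(\bar{x},0)$.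 *)

(* Defs.v *)
From HB Require Import structures.
From mathcomp Require Import all_boot all_order all_algebra.
From mathcomp Require Import all_classical all_reals all_analysis.
Set Implicit Arguments.
Unset Strict Implicit.
Unset Printing Implicit Defensive.
Import Order.TTheory GRing.Theory Num.Theory.
Import numFieldNormedType.Exports.
Local Open Scope classical_set_scope.
Local Open Scope ring_scope.

(* Lebesgue measure on R, on the completed (Lebesgue, not just Borel)
   sigma-algebra. [lebT R] is convertible to [R] and carries that
   sigma-algebra. *)
Notation leb := (@completed_lebesgue_measure _).
Notation lebT R := (caratheodory_type ((wlength (@idfun R))^*)%mu).

Section CTP.
Context {R : realType}.
Implicit Types (T r : R) (n p m k : nat).

(* Euclidean norm on row vectors, Frobenius norm on general matrices (the
   library norm of a matrix is the sup norm). *)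
Definition enorm k l (A : 'M[R]_(k, l)) : R :=
  Num.sqrt (\sum_i \sum_j A i j ^+ 2).

Definition grad n (f : 'rV[R]_n -> R) (x : 'rV[R]_n) : 'rV[R]_n :=
  \row_i 'D_(delta_mx 0 i) f x.

Definition C1 n (f : 'rV[R]_n -> R) : Prop :=
  (forall x, differentiable f x) /\ continuous (grad f).

(* ['J f x] is the transpose of the usual Jacobian matrix: column [i] is the
   gradient of the [i]-th component. *)
Definition C1v n k (f : 'rV[R]_n -> 'rV[R]_k) : Prop :=
  (forall x, differentiable f x) /\ continuous (fun x => 'J f x).

(* Functions on [0, T] are total functions on [R] of which only the
   restriction to [0, T] matters; elements of L^1 and L^oo are represented by
   functions, and equality of classes is equality a.e. on [0, T]. *)
Definition ae_on T (Q : R -> Prop) : Prop :=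
  \forall t \ae (@completed_lebesgue_measure R), t \in `[0, T] -> Q t.

Definition lmeasurable T (f : R -> R) : Prop :=
  measurable_fun (`[0, T] : set (lebT R)) (f : lebT R -> R).

Definition lintegrable T (f : R -> R) : Prop :=
  leb.-integrable `[0, T] (fun t => (f t)%:E).

Definition Linf T k : set (R -> 'rV[R]_k) :=
  [set x : R -> 'rV[R]_k | (forall i, lmeasurable T (fun t => x t 0 i)) /\
           exists M : R, ae_on T (fun t => enorm (x t) <= M)].

Definition L1 T k : set (R -> 'rV[R]_k) :=
  [set f : R -> 'rV[R]_k | forall i, lintegrable T (fun t => f t 0 i)].

Definition L1norm T k (f : R -> 'rV[R]_k) : \bar R :=
  (\int[leb]_(t in `[0%R, T]) (enorm (f t))%:E)%E.

(* Continuous linear functionals on L^1. Boundedness makes [l] invariant under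
   equality a.e. on [0, T]. *)
Definition L1dual T k (l : (R -> 'rV[R]_k) -> R) : Prop :=
  (forall (a : R) f1 f2, L1 T f1 -> L1 T f2 ->
     l (fun t => a *: f1 t + f2 t) = a * l f1 + l f2) /\
  exists C : R, forall f, L1 T f -> (`|l f|%:E <= C%:E * L1norm T f)%E.

Definition weak_L1 T k (fs : nat -> R -> 'rV[R]_k) (f : R -> 'rV[R]_k) : Prop :=
  forall l, L1dual T l -> (fun N => l (fs N)) @ \oo --> l f.

Definition feasible T n p m (h : 'rV[R]_n -> R -> 'rV[R]_p)
    (g : 'rV[R]_n -> R -> 'rV[R]_m) : set (R -> 'rV[R]_n) :=
  [set x : R -> 'rV[R]_n | Linf T x /\
     ae_on T (fun t => h (x t) t = 0 /\ forall j, g (x t) t 0 j <= 0)].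

Definition cost T n (phi : 'rV[R]_n -> R -> R) (x : R -> 'rV[R]_n) : \bar R :=
  (\int[leb]_(t in `[0%R, T]) (phi (x t) t)%:E)%E.

(* [cost] is only meaningful when [x] stays close to [xbar] (it is finite there
   under [H1]); as the radius [r'] may be shrunk, its value elsewhere does not
   affect this notion. *)
Definition local_optimal T n p m (phi : 'rV[R]_n -> R -> R)
    (h : 'rV[R]_n -> R -> 'rV[R]_p) (g : 'rV[R]_n -> R -> 'rV[R]_m)
    (xbar : R -> 'rV[R]_n) : Prop :=
  feasible T h g xbar /\
  exists2 r' : R, 0 < r' &
    forall x, feasible T h g x ->
      ae_on T (fun t => enorm (x t - xbar t) < r') ->
      (cost T phi xbar <= cost T phi x)%E.

Definition H1 T r n (phi : 'rV[R]_n -> R -> R) (xbar : R -> 'rV[R]_n) : Prop :=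
  [/\ ae_on T (fun t => C1 (phi^~ t)),
      forall x, lmeasurable T (phi x),
      lintegrable T (fun t => `|phi (xbar t) t|) &
      exists c chat : R -> R,
        [/\ lintegrable T c, lintegrable T chat,
            ae_on T (fun t => forall x y,
              enorm (x - xbar t) <= r -> enorm (y - xbar t) <= r ->
              `|phi x t - phi y t| <= c t * enorm (x - y)) &
            ae_on T (fun t => forall x, enorm (x - xbar t) <= r ->
              enorm (grad (phi^~ t) x) <= chat t)]].

Definition hg n p m (h : 'rV[R]_n -> R -> 'rV[R]_p)
    (g : 'rV[R]_n -> R -> 'rV[R]_m) (x : 'rV[R]_n) (t : R) : 'rV[R]_(p + m) :=
  row_mx (h x t) (g x t).

Definition H2 T r n p m (h : 'rV[R]_n -> R -> 'rV[R]_p)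
    (g : 'rV[R]_n -> R -> 'rV[R]_m) (xbar : R -> 'rV[R]_n) : Prop :=
  [/\ ae_on T (fun t => C1v ((hg h g)^~ t)),
      forall x i, lmeasurable T (fun t => hg h g x t 0 i),
      lintegrable T (fun t => enorm (hg h g (xbar t) t)) &
      exists c chat : R -> R,
        [/\ lintegrable T c, lintegrable T chat,
            ae_on T (fun t => forall x y,
              enorm (x - xbar t) <= r -> enorm (y - xbar t) <= r ->
              enorm (hg h g x t - hg h g y t) <= c t * enorm (x - y)) &
            ae_on T (fun t => forall x, enorm (x - xbar t) <= r ->
              enorm ('J ((hg h g)^~ t) x) <= chat t)]].

Definition mult_sum n p m (h : 'rV[R]_n -> R -> 'rV[R]_p)
    (g : 'rV[R]_n -> R -> 'rV[R]_m) (x : 'rV[R]_n) (t : R)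
    (u : 'rV[R]_p) (v : 'rV[R]_m) : 'rV[R]_n :=
  \sum_i u 0 i *: grad (fun y => h y t 0 i) x +
  \sum_j v 0 j *: grad (fun y => g y t 0 j) x.

Definition KKT T n p m (phi : 'rV[R]_n -> R -> R)
    (h : 'rV[R]_n -> R -> 'rV[R]_p) (g : 'rV[R]_n -> R -> 'rV[R]_m)
    (xbar : R -> 'rV[R]_n) : Prop :=
  feasible T h g xbar /\
  exists (u : R -> 'rV[R]_p) (v : R -> 'rV[R]_m), [/\ Linf T u, Linf T v &
    ae_on T (fun t =>
      grad (phi^~ t) (xbar t) + mult_sum h g (xbar t) t (u t) (v t) = 0 /\
      forall j, v t 0 j * g (xbar t) t 0 j = 0 /\ 0 <= v t 0 j)].

Definition Eset T r n (xbar : R -> 'rV[R]_n) : set (R -> 'rV[R]_n) :=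
  [set x : R -> 'rV[R]_n | Linf T x /\ ae_on T (fun t => enorm (x t - xbar t) < r)].

Definition Fset T m : set (R -> 'rV[R]_m) :=
  [set theta : R -> 'rV[R]_m | L1 T theta /\ ae_on T (fun t => forall j, 0 <= theta t 0 j)].

Definition gminus n m (g : 'rV[R]_n -> R -> 'rV[R]_m) (j : 'I_m)
    (x : 'rV[R]_n) (t : R) : R :=
  Num.max (- g x t 0 j) 0.

Definition Mset T n p m (h : 'rV[R]_n -> R -> 'rV[R]_p)
    (g : 'rV[R]_n -> R -> 'rV[R]_m) (x : R -> 'rV[R]_n) (theta : R -> 'rV[R]_m)
    : set (R -> 'rV[R]_n) :=
  [set psi : R -> 'rV[R]_n | L1 T psi /\
     exists (u : R -> 'rV[R]_p) (v : R -> 'rV[R]_m), [/\ Linf T u, Linf T v &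
       ae_on T (fun t =>
         psi t = mult_sum h g (x t) t (u t) (v t) /\
         forall j, v t 0 j * gminus g j (x t) t = theta t 0 j /\
                   0 <= v t 0 j)]].

Definition wlimsup_M T r n p m (h : 'rV[R]_n -> R -> 'rV[R]_p)
    (g : 'rV[R]_n -> R -> 'rV[R]_m) (xbar : R -> 'rV[R]_n)
    : set (R -> 'rV[R]_n) :=
  [set psi : R -> 'rV[R]_n | L1 T psi /\
     exists (xs : nat -> R -> 'rV[R]_n) (thetas : nat -> R -> 'rV[R]_m)
            (psis : nat -> R -> 'rV[R]_n),
       [/\ forall k, Eset T r xbar (xs k) /\ Fset T (thetas k),
           ae_on T (fun t => (fun k => xs k t) @ \oo --> xbar t /\
                             (fun k => thetas k t) @ \oo --> (0 : 'rV[R]_m)),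
           forall k, Mset T h g (xs k) (thetas k) (psis k) &
           weak_L1 T psis psi]].

Definition AKKT_regular T r n p m (h : 'rV[R]_n -> R -> 'rV[R]_p)
    (g : 'rV[R]_n -> R -> 'rV[R]_m) (xbar : R -> 'rV[R]_n) : Prop :=
  wlimsup_M T r h g xbar `<=` Mset T h g xbar (fun=> 0).

End CTP.

(* Main.v *)
From HB Require Import structures.
Require Import Defs.
From mathcomp Require Import all_boot all_order all_algebra.
From mathcomp Require Import all_classical all_reals all_analysis.
From mathcomp Require Import measurable_realfun ring lra.
Set Implicit Arguments.
Unset Strict Implicit.
Unset Printing Implicit Defensive.
Import Order.TTheory GRing.Theory Num.Theory.
Import numFieldNormedType.Exports.
Local Open Scope classical_set_scope.
Local Open Scope ring_scope.

(** The constraints and the cost of the problem are local in time, so the whole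
    argument takes place at a fixed time [t], and measure theory is needed only
    to move between statements about functions and statements about almost
    every [t].

    - Local optimality is pointwise. If on a non-null set of times some feasible
      point near [xbar t] had a smaller cost, a measurable choice of such points
      ([measurable_selection]) would give a feasible competitor of smaller
      integral cost. Hence [xbar t] locally minimises [phi^~ t] under the
      constraints for almost every [t] ([pointwise_optimal]).

    - At such a [t] the quadratic penalty method applies ([approx_stationary]):
      minimising [phi + |x - xbar t|^2 / 2 + k / 2 (|h|^2 + |g^+|^2)] over a
      small ball gives points [x] close to [xbar t] at which [grad phi] plus the
      combination of the gradients of [h] and [g] with multipliers [k h] and
      [k g^+] is small. These multipliers satisfy [v_j g_j^- = 0] exactly, so
      that [theta = 0] along the whole sequence.

    - Minimisers are then replaced by countably many measurable candidates
      [xbar + q] with [q] rational, [k] a natural number, and multipliers cut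
      off at a natural number [M]. At each time the best of the first [N]
      candidates is kept ([running_best]); each of these is a measurable triple
      with essentially bounded multipliers, and its error tends to [0] at almost
      every time ([candidate_small]). The trivial candidate [(xbar, 0, 0)] has
      error [|grad phi (xbar t)|], which is integrable, so dominated convergence
      turns this into convergence in [L^1], a fortiori weak convergence, of the
      multiplier sums to [- grad phi (xbar)] ([neg_grad_wlimsup]).

    Regularity puts [- grad phi (xbar)] in [M (xbar, 0)], which is the KKT
    system. *)

(** * Norms on row vectors, density and compactness *)

Section euclidean.
Context {R : realType}.

Lemma mxnorm_ltP n (y : 'rV[R]_n) e : 0 < e ->
  `|y| < e <-> forall i, `|y 0 i| < e.
Proof.
move=> e0; rewrite [`|y|]mx_normrE; split.
  by move=> /bigmax_ltP[_ H] i; exact: (H (0, i)).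
by move=> H; apply/bigmax_ltP; split => // -[i j] _ /=; rewrite (ord1 i).
Qed.

Lemma mxnorm_leP n (y : 'rV[R]_n) e : 0 <= e ->
  `|y| <= e <-> forall i, `|y 0 i| <= e.
Proof.
move=> e0; rewrite [`|y|]mx_normrE; split.
  by move=> /bigmax_leP[_ H] i; exact: (H (0, i)).
by move=> H; apply/bigmax_leP; split => // -[i j] _ /=; rewrite (ord1 i).
Qed.

Lemma coord_le_mxnorm n (y : 'rV[R]_n) i : `|y 0 i| <= `|y|.
Proof. by apply: (mxnorm_leP _ _).1. Qed.

Lemma coord_le_enorm n (y : 'rV[R]_n) i : `|y 0 i| <= enorm y.
Proof.
rewrite -sqrtr_sqr /enorm big_ord1 ler_wsqrtr//.
by rewrite (bigD1 i)//= lerDl sumr_ge0// => j _; exact: sqr_ge0.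
Qed.

Lemma enorm_ge0 k l (A : 'M[R]_(k, l)) : 0 <= enorm A.
Proof. exact: sqrtr_ge0. Qed.

Lemma mxnorm_le_enorm n (y : 'rV[R]_n) : `|y| <= enorm y.
Proof. by apply/mxnorm_leP; [exact: enorm_ge0|exact: coord_le_enorm]. Qed.

Lemma enorm_le_mxnorm n (y : 'rV[R]_n) : enorm y <= n%:R * `|y|.
Proof.
rewrite -[leRHS]ger0_norm ?mulr_ge0//.
rewrite -sqrtr_sqr /enorm big_ord1 ler_wsqrtr// exprMn.
apply: (@le_trans _ _ (\sum_(i < n) `|y| ^+ 2)).
  apply: ler_sum => i _; rewrite -(real_normK (num_real (y 0 i))).
  by rewrite lerXn2r ?nnegrE// coord_le_mxnorm.
rewrite sumr_const card_ord -[leLHS]mulr_natl ler_wpM2r ?sqr_ge0//.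
by rewrite -natrX ler_nat; case: (n) => // k; rewrite leq_pmulr.
Qed.

Lemma enorm0 k l : enorm (0 : 'M[R]_(k, l)) = 0.
Proof.
rewrite /enorm big1 ?sqrtr0// => i _; rewrite big1// => j _.
by rewrite mxE expr0n.
Qed.

(** Rational vectors, enumerated through the countable type structure of
    matrices; indices that encode no vector are sent to [0]. *)
Definition rat_vec n (i : nat) : 'rV[R]_n :=
  if unpickle i is Some q then map_mx ratr (q : 'rV[rat]_n) else 0.

Lemma rat_vec_dense n (y : 'rV[R]_n) e : 0 < e ->
  exists i, enorm (y - rat_vec n i) < e.
Proof.
move=> e0; pose d := e / n.+1%:R.
have d0 : 0 < d by rewrite divr_gt0.
have h j : exists q : rat, `|y 0 j - ratr q| < d.
  have : y 0 j - d < y 0 j + d by lra.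
  move=> /rat_in_itvoo[q]; rewrite in_itv/= => /andP[q1 q2].
  by exists q; rewrite ltr_norml; apply/andP; split; lra.
have [q qP] := choice h.
exists (pickle (\row_j q j)); apply: (le_lt_trans (enorm_le_mxnorm _)).
set v := (X in `|X|); have vd : `|v| < d.
  by apply/mxnorm_ltP => // j; rewrite /v /rat_vec pickleK !mxE.
apply: (@le_lt_trans _ _ (n.+1%:R * `|v|)).
  by rewrite ler_wpM2r// ler_nat.
by rewrite mulrC -ltr_pdivlMr.
Qed.

Lemma continuous_sumr (T : topologicalType) (V : normedModType R) (I : finType)
    (F : I -> T -> V) :
  (forall i, continuous (F i)) -> continuous (fun x => \sum_i F i x).
Proof.
move=> cF; apply: continuous_big => //; exact: add_continuous.
Qed.

Lemma continuous_subr (T : topologicalType) (f g : T -> R) :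
  continuous f -> continuous g -> continuous (fun x => f x - g x).
Proof. by move=> cf cg x; exact: (continuousB (cf x) (cg x)). Qed.

Lemma continuous_dist (V : normedModType R) (x : V) :
  continuous (fun y => `|x - y|).
Proof.
by move=> y; apply: cvg_norm; apply: cvgB; [exact: cvg_cst|exact: cvg_id].
Qed.

Lemma continuous_maxr (T : topologicalType) (f g : T -> R) :
  continuous f -> continuous g -> continuous (fun x => Num.max (f x) (g x)).
Proof. by move=> cf cg x; exact: (continuous_max (cf x) (cg x)). Qed.

Lemma continuous_addr (T : topologicalType) (f g : T -> R) :
  continuous f -> continuous g -> continuous (fun x => f x + g x).
Proof. by move=> cf cg x; exact: (continuousD (cf x) (cg x)). Qed.

Lemma continuous_mulr (T : topologicalType) (f g : T -> R) :
  continuous f -> continuous g -> continuous (fun x => f x * g x).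
Proof. by move=> cf cg x; exact: (continuousM (cf x) (cg x)). Qed.

Lemma continuous_sqrr (T : topologicalType) (f : T -> R) :
  continuous f -> continuous (fun x => f x ^+ 2).
Proof. by move=> cf; exact: continuous_mulr. Qed.

Lemma continuous_enorm (T : topologicalType) n (f : T -> 'rV[R]_n) :
  (forall j, continuous (fun x => f x 0 j)) ->
  continuous (fun x => enorm (f x)).
Proof.
move=> cf x; apply: (@continuous_comp _ _ _
    (fun x => \sum_i \sum_j f x i j ^+ 2) Num.sqrt); last exact: sqrt_continuous.
apply: continuous_sumr => i; apply: continuous_sumr => j.
by apply: continuous_sqrr; rewrite (ord1 i).
Qed.

(** Cantor's intersection theorem, which replaces the extraction of convergent
    subsequences throughout. *)
Lemma nested_closed_nonempty n (F : nat -> set 'rV[R]_n) (M : R) :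
  (forall i, closed (F i)) -> (forall i, F i.+1 `<=` F i) ->
  (forall i, F i !=set0) -> (forall y, F 0%N y -> `|y| <= M) ->
  exists y, forall i, F i y.
Proof.
move=> clF decF neF bF.
have cF0 : compact (F 0%N).
  apply: bounded_closed_compact => //.
  exists M; split; first exact: num_real.
  by move=> x Mx y /bF /le_trans; apply; exact: ltW.
have [z zP] := choice neF.
have dec i j : (i <= j)%N -> F j `<=` F i.
  elim: j => [|j ih]; first by rewrite leqn0 => /eqP ->.
  by rewrite leq_eqVlt ltnS => /orP[/eqP->//|/ih h] y /decF /h.
have [|p [_ pP]] := cF0 (z @ \oo) _.
  by exists 0%N => // i _ /=; exact: (@dec 0%N i) (zP i).
exists p => i; apply: clF => B pB; apply: pP pB.
by exists i => // j /= ij; exact: (dec i j) (zP j).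
Qed.

End euclidean.
(** * Caratheodory functions *)

Section caratheodory.
Context {R : realType} d (X : measurableType d).
Implicit Types (D : set X) (n : nat).

Lemma invSn_lt (e : R) : 0 < e -> exists k : nat, k.+1%:R^-1 < e.
Proof.
move=> e0; have [k _ kP] := near_infty_natSinv_lt (PosNum e0).
by exists k; exact: (kP k (leqnn k)).
Qed.

Lemma cvg_at_enorm n (f : 'rV[R]_n -> R) x e :
  {for x, continuous f} -> 0 < e ->
  exists2 a, 0 < a & forall y, enorm (x - y) < a -> `|f x - f y| < e.
Proof.
move=> /cvgrPdist_lt/(_ _)/[apply]/nbhs_ballP[a a0 aP]; exists a => // y ya.
apply: aP; rewrite -ball_normE/=; exact: le_lt_trans (mxnorm_le_enorm _) ya.
Qed.

Lemma measurable_fun_ltP D (f : X -> R) : measurable D ->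
  (forall c, measurable (D `&` [set t | f t < c])) -> measurable_fun D f.
Proof.
move=> mD mf _; apply: (measurability _ (RGenInftyO.measurableE R)) => //.
by move=> /= _ [_ [c ->] <-]; rewrite preimage_itvNyo; exact: mf.
Qed.

Lemma measurable_set_ltr D (f g : X -> R) : measurable D ->
  measurable_fun D f -> measurable_fun D g ->
  measurable (D `&` [set t | f t < g t]).
Proof.
by move=> mD mf mg; exact: (measurable_fun_ltr mf mg mD (Y := [set true])).
Qed.

Definition measurable_rV D n (z : X -> 'rV[R]_n) :=
  forall i, measurable_fun D (fun t => z t 0 i).

Lemma measurable_fun_enorm D n (z : X -> 'rV[R]_n) :
  measurable_rV D z -> measurable_fun D (fun t => enorm (z t)).
Proof.
move=> mz; apply: (@measurableT_comp _ _ _ _ _ _ (@Num.sqrt R)).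
  by apply: continuous_measurable_fun; exact: sqrt_continuous.
apply: measurable_sum => i; apply: measurable_sum => j.
by rewrite (ord1 i); exact: measurable_funX.
Qed.

Lemma measurable_rVB D n (z w : X -> 'rV[R]_n) :
  measurable_rV D z -> measurable_rV D w ->
  measurable_rV D (fun t => z t - w t).
Proof.
move=> mz mw i; under eq_fun do rewrite !mxE.
exact: measurable_funB.
Qed.

Lemma measurable_rVD D n (z w : X -> 'rV[R]_n) :
  measurable_rV D z -> measurable_rV D w ->
  measurable_rV D (fun t => z t + w t).
Proof.
move=> mz mw i; under eq_fun do rewrite !mxE.
exact: measurable_funD.
Qed.

Lemma measurable_rV_cst D n (q : 'rV[R]_n) : measurable_rV D (fun=> q).
Proof. by move=> i; exact: measurable_cst. Qed.

Lemma measurable_rV_patch D (S : set X) n (z w : X -> 'rV[R]_n) :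
  measurable D -> measurable S -> S `<=` D ->
  measurable_rV S z -> measurable_rV D w ->
  measurable_rV D (fun t => if `[< S t >] then z t else w t).
Proof.
move=> mD mS SD mz mw i; rewrite -(setDUK SD); apply/measurable_funU => //.
  exact: measurableD.
split; [apply: eq_measurable_fun (mz i)|apply: eq_measurable_fun].
- by move=> t /set_mem St; rewrite asboolT.
- by move=> t /set_mem[Dt St]; rewrite asboolF.
- by apply: measurable_funS (mw i) => // t [].
Qed.

Lemma measurable_rVS D (S : set X) n (z : X -> 'rV[R]_n) :
  measurable D -> S `<=` D -> measurable_rV D z -> measurable_rV S z.
Proof. by move=> mD SD mz i; exact: measurable_funS (mz i). Qed.

Lemma measurable_rV_if D n (b : X -> bool) (z w : X -> 'rV[R]_n) :
  measurable D -> measurable_fun D b ->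
  measurable_rV D z -> measurable_rV D w ->
  measurable_rV D (fun t => if b t then z t else w t).
Proof.
move=> mD mb mz mw i.
rewrite (_ : (fun t => _) = fun t => if b t then z t 0 i else w t 0 i).
  apply: measurable_fun_if => //; first exact: measurable_funS (mz i).
  exact: measurable_funS (mw i).
by apply/funext => t; case: ifP.
Qed.

Lemma measurable_sumM D (I : finType) (a b : I -> X -> R) :
  (forall i, measurable_fun D (a i)) -> (forall i, measurable_fun D (b i)) ->
  measurable_fun D (fun t => \sum_i a i t * b i t).
Proof. by move=> ma mb; apply: measurable_sum => i; exact: measurable_funM. Qed.

Lemma measurable_rVZ D n k (z : X -> 'rV[R]_n) :
  measurable_rV D z -> measurable_rV D (fun t => k *: z t).
Proof.
by move=> mz i; under eq_fun do rewrite mxE; exact: measurable_funM.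
Qed.

Lemma measurable_row D n (f : 'I_n -> X -> R) :
  (forall i, measurable_fun D (f i)) -> measurable_rV D (fun t => \row_i f i t).
Proof. by move=> mf i; under eq_fun do rewrite mxE; exact: mf. Qed.

Lemma measurable_pos_part D k (f : X -> R) : measurable_fun D f ->
  measurable_fun D (fun t => k * Num.max (f t) 0).
Proof. by move=> mf; apply: measurable_funM => //; exact: measurable_maxr. Qed.

Lemma measurable_enorm_le D n (z : X -> 'rV[R]_n) M : measurable_rV D z ->
  measurable_fun D (fun t => enorm (z t) <= M).
Proof.
by move=> mz; apply: measurable_fun_ler => //; exact: measurable_fun_enorm.
Qed.

Definition carath D n (f : 'rV[R]_n -> X -> R) :=
  (forall y, measurable_fun D (f y)) /\
  (forall t, D t -> continuous (f^~ t)).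

(** Superposition: [f (z t) t < c] holds exactly when, for some [k], the
    measurable bound [f q t <= c - 1 / (k + 1)] holds at all rational [q] that
    are [1 / (k + 1)]-close to [z t]. No approximation of [z] is needed. *)
Lemma measurable_carath D n (f : 'rV[R]_n -> X -> R) (z : X -> 'rV[R]_n) :
  measurable D -> carath D f -> measurable_rV D z ->
  measurable_fun D (fun t => f (z t) t).
Proof.
move=> mD [mf cf] mz; apply: measurable_fun_ltP => // c.
pose S k i := D `&` [set t |
  (k.+1%:R^-1 <= enorm (z t - rat_vec n i)) ||
  (f (rat_vec n i) t <= c - k.+1%:R^-1)].
rewrite (_ : _ `&` _ = \bigcup_k \bigcap_i S k i); last first.
  apply/seteqP; split => [t [Dt /= fc]|t [k _ Skt]].
    have e0 : 0 < (c - f (z t) t) / 2 by lra.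
    have [a a0 aP] := cvg_at_enorm (cf _ Dt (z t)) e0.
    have [k] : exists k : nat, k.+1%:R^-1 < Num.min a ((c - f (z t) t) / 2).
      by apply: invSn_lt; rewrite lt_min a0.
    rewrite lt_min => /andP[ka kc].
    exists k => // i _; split => //=; case: leP => //= zq.
    have := aP _ (lt_trans zq ka); rewrite ltr_norml => /andP[].
    by move: kc; set k1 := k.+1%:R^-1; lra.
  have [Dt _] := Skt 0%N Logic.I; split => //=; rewrite ltNge; apply/negP => cz.
  have k0 : 0 < k.+1%:R^-1 :> R by [].
  have [a a0 aP] := cvg_at_enorm (cf _ Dt (z t)) k0.
  have : 0 < Num.min a k.+1%:R^-1 by rewrite lt_min a0.
  move=> /(rat_vec_dense (z t))[i]; rewrite lt_min => /andP[/aP ia ik].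
  have [_ /=] := Skt i Logic.I; rewrite leNgt ik/=.
  move: ia cz; rewrite ltr_norml => /andP[].
  by set k1 := k.+1%:R^-1; lra.
apply: bigcupT_measurable => k; apply: bigcapT_measurable => i.
have mb : measurable_fun D (fun t =>
    (k.+1%:R^-1 <= enorm (z t - rat_vec n i)) ||
    (f (rat_vec n i) t <= c - k.+1%:R^-1)).
  apply: measurable_or; last by apply: measurable_fun_ler => //; exact: mf.
  apply: measurable_fun_ler => //; apply: measurable_fun_enorm.
  by apply: measurable_rVB => //; exact: measurable_rV_cst.
exact: (mb mD [set true]).
Qed.

Lemma carathD D n (f g : 'rV[R]_n -> X -> R) :
  carath D f -> carath D g -> carath D (fun y t => f y t + g y t).
Proof.
move=> [mf cf] [mg cg]; split => [y|t Dt y].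
  exact: measurable_funD.
by apply: continuousD; [exact: cf|exact: cg].
Qed.

Lemma carath_max D n (f g : 'rV[R]_n -> X -> R) :
  carath D f -> carath D g -> carath D (fun y t => Num.max (f y t) (g y t)).
Proof.
move=> [mf cf] [mg cg]; split => [y|t Dt].
  exact: measurable_maxr.
by apply: continuous_maxr; [exact: cf|exact: cg].
Qed.

Lemma carath_cst D n (g : X -> R) :
  measurable_fun D g -> carath D (fun (_ : 'rV[R]_n) t => g t).
Proof. by move=> mg; split => // t _ y; exact: cst_continuous. Qed.

Lemma carath_fixed D n (a : 'rV[R]_n -> R) :
  continuous a -> carath D (fun y _ => a y).
Proof. by move=> ca; split => // t _. Qed.

Lemma carath_shift D n (f : 'rV[R]_n -> X -> R) (z : X -> 'rV[R]_n) :
  measurable D -> carath D f -> measurable_rV D z ->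
  carath D (fun y t => f (z t + y) t).
Proof.
move=> mD fC mz; split => [y|t Dt y].
  apply: (measurable_carath (z := fun t => z t + y)) => //.
  by apply: (measurable_rVD mz (w := fun=> y)); exact: measurable_rV_cst.
apply: (@continuous_comp _ _ _ (fun y => z t + y) (f^~ t)).
  by apply: continuousD; [exact: cst_continuous|exact: cvg_id].
exact: fC.2.
Qed.

Lemma carath_sum D n (I : finType) (f : I -> 'rV[R]_n -> X -> R) :
  (forall i, carath D (f i)) -> carath D (fun y t => \sum_i f i y t).
Proof.
move=> fC; split => [y|t Dt].
  by apply: measurable_sum => i; exact: (fC i).1.
by apply: continuous_sumr => i; exact: (fC i).2.
Qed.

Lemma carath_norm D n (f : 'rV[R]_n -> X -> R) :
  carath D f -> carath D (fun y t => `|f y t|).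
Proof.
move=> [mf cf]; split => [y|t Dt y].
  by apply: measurableT_comp => //; exact: normr_measurable.
apply: (@continuous_comp _ _ _ (f^~ t) Num.norm); first exact: cf.
exact: norm_continuous.
Qed.

End caratheodory.
(** * Measurable selection *)

Section measurable_selection.
Context {R : realType} d (X : measurableType d).
Implicit Types (D : set X) (n : nat).

Lemma closed_sublevel n (f : 'rV[R]_n -> R) c :
  continuous f -> closed [set y | f y <= c].
Proof.
move=> cf; rewrite (_ : [set y | _] = f @^-1` [set x | x <= c]) //.
apply: closed_comp; last exact: closed_le.
by move=> y _; exact: cf.
Qed.

Definition coercive D n (delta : R) (G : 'rV[R]_n -> X -> R) :=
  forall t, D t -> forall y, enorm y <= delta + G y t.

(** By coercivity and continuity, [G y t <= 0] has a solution exactly when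
    [G q t < 1 / (k + 1)] has a rational solution for every [k]. *)
Lemma measurable_solvable D n delta (G : 'rV[R]_n -> X -> R) :
  measurable D -> carath D G -> coercive D delta G ->
  measurable (D `&` [set t | exists y, G y t <= 0]).
Proof.
move=> mD [mG cG] coG.
rewrite (_ : _ `&` _ = \bigcap_k \bigcup_i
    (D `&` [set t | G (rat_vec n i) t < k.+1%:R^-1])); last first.
  apply/seteqP; split => [t [Dt /= [y Gy]] k _|t Gt].
    have k0 : 0 < k.+1%:R^-1 :> R by [].
    have [a a0 aP] := cvg_at_enorm (cG _ Dt y) k0.
    have [i /aP iP] := rat_vec_dense y a0; exists i => //; split => //=.
    by move: iP; rewrite ltr_norml => /andP[]; set k1 := k.+1%:R^-1; lra.
  have Dt : D t by have [? _ []] := Gt 0%N Logic.I.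
  split => //=.
  have [||||y yP] :=
      @nested_closed_nonempty _ _ (fun k => [set y | G y t <= k.+1%:R^-1])
        (delta + 1).
  - by move=> k; apply: closed_sublevel; exact: cG.
  - move=> k y /= /le_trans; apply.
    by rewrite lef_pV2 ?posrE// ler_nat.
  - by move=> k; have [i _ [_ /= Gi]] := Gt k Logic.I; eexists; exact: ltW Gi.
  - move=> y; rewrite /= invr1 => Gy.
    apply: le_trans (mxnorm_le_enorm _) _; apply: le_trans (coG _ Dt y) _.
    by rewrite lerD2l.
  exists y; rewrite leNgt; apply/negP => /invSn_lt[k].
  by rewrite ltNge; apply/negP/negPn/yP.
apply: bigcapT_measurable => k; apply: bigcupT_measurable => i.
exact: measurable_set_ltr.
Qed.

Definition half_space n (i : nat) (y : 'rV[R]_n) : R :=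
  if unpickle i is Some (j, s) then y 0 (j : 'I_n) - ratr (s : rat) else 0.

Lemma half_space_continuous n i : continuous (@half_space n i).
Proof.
rewrite /half_space; case: unpickle => [[j s]|]; last exact: cst_continuous.
by apply: continuous_subr; [exact: coord_continuous|exact: cst_continuous].
Qed.

Section trim.
Variables (n : nat) (G : 'rV[R]_n -> X -> R).

(** Greedy cutting makes the selected point of the solution set depend on [t]
    only through countably many yes-or-no questions, one for each half-space. *)
Fixpoint trim (t : X) (i : nat) : set 'rV[R]_n :=
  if i is i'.+1 then
    if `[< exists y, trim t i' y /\ half_space i' y <= 0 >]
    then trim t i' `&` [set y | half_space i' y <= 0] else trim t i'
  else [set y | G y t <= 0].

Lemma trim_sub t i : trim t i.+1 `<=` trim t i.
Proof. by rewrite /=; case: ifP => _ y => [[]|]. Qed.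

Lemma trim_closed t i : continuous (G^~ t) -> closed (trim t i).
Proof.
move=> cG; elim: i => [|i ih /=]; first exact: closed_sublevel.
case: ifP => // _; apply: closedI => //; apply: closed_sublevel.
exact: half_space_continuous.
Qed.

Lemma trim_nonempty t i : trim t 0 !=set0 -> trim t i !=set0.
Proof.
move=> t0; elim: i => // i ih /=; case: ifPn => // /asboolP[y [yt yi]].
by exists y.
Qed.

(** A half-space that met the set at its turn was used for a cut, and [y]
    survives all cuts. *)
Lemma trim_half_space t y i : (forall k, trim t k y) ->
  half_space i y <= 0 <-> exists z, trim t i z /\ half_space i z <= 0.
Proof.
move=> ty; split => [yi|zi]; first by exists y.
by have /= := ty i.+1; rewrite asboolT// => -[].
Qed.

(** Knowing which half-spaces were used so far amounts to finitely many
    solvability questions for [G] with extra inequalities, whence the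
    arbitrary side constraint [a]. *)
Lemma measurable_trim D delta i (a : 'rV[R]_n -> R) : measurable D ->
  carath D G -> coercive D delta G -> continuous a ->
  measurable (D `&` [set t | exists y, trim t i y /\ a y <= 0]).
Proof.
move=> mD GC coG; elim: i a => [|i ih] a ca.
  rewrite (_ : [set t | _] = [set t | exists y, Num.max (G y t) (a y) <= 0]).
    have cGa := carath_max GC (carath_fixed D ca).
    apply: (measurable_solvable (delta := delta) mD cGa).
    move=> t Dt y; apply: le_trans (coG _ Dt y) _.
    by rewrite lerD2l le_max lexx.
  apply/seteqP; split => t /= [y yP]; exists y.
    by rewrite ge_max; apply/andP.
  by move: yP; rewrite ge_max => /andP.
pose S (b : 'rV[R]_n -> R) := D `&` [set t | exists y, trim t i y /\ b y <= 0].
rewrite (_ : _ `&` _ = (S (@half_space n i) `&`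
    S (fun y => Num.max (half_space i y) (a y))) `|`
    (S a `\` S (@half_space n i))); last first.
  apply/seteqP; split => [t [Dt /= [y []]]|t].
    case: ifPn => [/asboolP h [yt yi] ya|/asboolPn h yt ya]; [left|right].
      by split; split => //; exists y; rewrite ge_max yi.
    by split; [split => //; exists y|move=> [_]].
  move=> [[[Dt h] [_ [y [yt ym]]]]|[[Dt [y [yt ya]]] h]]; split => //; exists y.
    by move: ym; rewrite ge_max /= asboolT// => /andP[].
  rewrite /= asboolF// => h'; exact: h.
have ch := @half_space_continuous n i.
apply: measurableU; [apply: measurableI|apply: measurableD]; apply: ih => //.
exact: continuous_maxr.
Qed.

End trim.

(** The selection is any point that survives all cuts. By [trim_half_space],
    the times at which its [j]-th coordinate is at most a rational [s] are those
    at which the corresponding half-space was used, a measurable set by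
    [measurable_trim]. *)
Lemma measurable_selection D n delta (G : 'rV[R]_n -> X -> R) :
  measurable D -> carath D G -> coercive D delta G ->
  exists z : X -> 'rV[R]_n,
    measurable_rV (D `&` [set t | exists y, G y t <= 0]) z /\
    forall t, D t -> (exists y, G y t <= 0) -> G (z t) t <= 0.
Proof.
move=> mD GC coG; set S := D `&` _.
have ex t : exists y, S t -> forall i, trim G t i y.
  have [St|nSt] := pselect (S t); last by exists 0.
  have [Dt [y0 Gy0]] := St.
  have [||||y yP] := @nested_closed_nonempty _ _ (trim G t) delta; last 1 first.
  - by exists y.
  - by move=> i; apply: trim_closed; exact: GC.2.
  - by move=> i; exact: trim_sub.
  - by move=> i; apply: trim_nonempty; exists y0.
  - move=> y /= Gy; apply: le_trans (mxnorm_le_enorm _) _.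
    by apply: le_trans (coG _ Dt y) _; rewrite gerDl.
have [z zP] := choice ex; exists z; split; last first.
  by move=> t Dt Gt; exact: (zP t (conj Dt Gt) 0%N).
have mS : measurable S by exact: measurable_solvable coG.
move=> j; apply: measurable_fun_ltP => // c.
rewrite (_ : _ `&` _ = \bigcup_(s in [set s : rat | ratr s < c])
    (S `&` [set t | z t 0 j <= ratr s])); last first.
  apply/seteqP; split => [t [St /= /rat_in_itvoo[q]]|t [s /= sc [St /= zs]]].
    rewrite in_itv/= => /andP[zq qc]; exists q => //.
    by split => //=; exact: ltW.
  by split => //=; exact: le_lt_trans sc.
rewrite bigcup_mkcond; apply: bigcupT_measurable_rat => s; case: ifP => // _.
pose i := pickle (j, s).
rewrite (_ : [set t | _ ] = [set t | half_space i (z t) <= 0]); last first.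
  by apply/funext => t /=; rewrite /half_space pickleK subr_le0.
rewrite (_ : _ `&` _ = S `&` (D `&`
    [set t | exists y, trim G t i y /\ half_space i y <= 0])); last first.
  apply/seteqP; split => t [St].
    move=> /(trim_half_space _ (zP t St)) h; split => //; split => //.
    exact: St.1.
  by move=> [_ /(trim_half_space _ (zP t St))].
apply: measurableI => //; apply: measurable_trim coG _ => //.
exact: half_space_continuous.
Qed.

End measurable_selection.
(** * The quadratic penalty method at a fixed time *)

Section pointwise_penalty.
Context {R : realType}.
Implicit Types (n : nat).

(** Fermat's rule in the direction [v]. *)
Lemma derive_local_min n (f : 'rV[R]_n -> R) x v e : 0 < e ->
  (forall y, derivable f y v) ->
  (forall y, `|x - y| < e -> f x <= f y) -> 'D_v f x = 0.
Proof.
move=> e0 df fmin; pose f1 (s : R) := f (s *: v + x).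
have v1 : 0 < `|v| + 1 by rewrite ltr_wpDl.
pose a := e / (`|v| + 1).
have a0 : 0 < a by rewrite divr_gt0.
have f10 : f1 0 = f x by rewrite /f1 scale0r add0r.
have : is_derive (0 : R) 1 f1 0.
  apply: (@derive1_at_min _ f1 (- a) a 0).
  - by rewrite (@le_trans _ _ 0)// ?ltW// oppr_lt0.
  - move=> s _; have := df (s *: v + x).
    rewrite /derivable; set g1 := fun h => h^-1 *: _; set g2 := fun h => h^-1 *: _.
    suff -> : g1 = g2 by [].
    rewrite funeqE /g1 /g2 /f1 => h /=.
    by rewrite [_%:A]mulr1 scalerDl addrA.
  - by rewrite in_itv/= oppr_lt0 a0.
  - move=> s; rewrite in_itv/= -ltr_norml => sa; rewrite f10; apply: fmin.
    rewrite opprD addrC -addrA addNr addr0 normrN normrZ.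
    apply: (@le_lt_trans _ _ (`|s| * (`|v| + 1))).
      by rewrite ler_wpM2l// lerDl.
    by rewrite -ltr_pdivlMr.
move=> [_ f1D]; rewrite -[RHS]f1D /derive.
set g1 := fun h => h^-1 *: _; set g2 := fun h => h^-1 *: _.
suff -> : g1 = g2 by [].
rewrite funeqE /g1 /g2 /f1 => h /=.
by rewrite addr0 scale0r add0r [_%:A]mulr1.
Qed.

Lemma is_derive_sqr n (f : 'rV[R]_n -> R) x v df : is_derive x v f df ->
  is_derive x v (fun y => f y ^+ 2) (2 * f x * df).
Proof.
move=> fd; have := is_deriveX 2 fd.
by rewrite expr1.
Qed.

Lemma is_derive_bigsum n k (F : 'I_k -> 'rV[R]_n -> R) x v (dF : 'I_k -> R) :
  (forall i, is_derive x v (F i) (dF i)) ->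
  is_derive x v (fun y => \sum_i F i y) (\sum_i dF i).
Proof.
move=> Fd; have := is_derive_sum Fd.
by rewrite (_ : \sum_i F i = fun y => \sum_i F i y)// fct_sumE.
Qed.

Lemma is_derive_cstD n (f : 'rV[R]_n -> R) x v df c : is_derive x v f df ->
  is_derive x v (fun y => c + f y) df.
Proof.
move=> fd; rewrite -[df]add0r; exact: is_deriveD (is_derive_cst c x v) fd.
Qed.

Lemma is_derive_coord n (x v : 'rV[R]_n) i :
  is_derive x v (fun y : 'rV[R]_n => y 0 i) (v 0 i).
Proof.
pose f (y : 'rV[R]_n) : R := y 0 i.
have lf : linear f by move=> a u w; rewrite /f !mxE.
pose F := GRing.isLinear.Build R _ _ _ f lf.
pose L : {linear 'rV[R]_n -> R} := HB.pack f F.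
have cL : continuous L by exact: coord_continuous.
have dL : differentiable L x by exact: linear_differentiable.
apply: DeriveDef; first exact: (diff_derivable dL).
by rewrite (deriveE v dL) diff_lin.
Qed.

Section penalty.
Variables (n p m : nat) (phi : 'rV[R]_n -> R) (H : 'I_p -> 'rV[R]_n -> R)
  (G : 'I_m -> 'rV[R]_n -> R) (xb : 'rV[R]_n).
Hypotheses (dphi : forall y, differentiable phi y)
  (dH : forall l y, differentiable (H l) y)
  (dG : forall j y, differentiable (G j) y).

Let infeas y := \sum_l H l y ^+ 2 + \sum_j Num.max (G j y) 0 ^+ 2.
Let prox (y : 'rV[R]_n) := \sum_i (y 0 i - xb 0 i) ^+ 2.
Let penal (k : nat) y := phi y + 2^-1 * prox y + k%:R / 2 * infeas y.

Let infeas_ge0 y : 0 <= infeas y.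
Proof. by apply: addr_ge0; apply: sumr_ge0 => i _; exact: sqr_ge0. Qed.

Let prox_ge0 y : 0 <= prox y.
Proof. by apply: sumr_ge0 => i _; exact: sqr_ge0. Qed.

Let penal_continuous k : continuous (penal k).
Proof.
have cc (a : R) : continuous (fun _ : 'rV[R]_n => a) by exact: cst_continuous.
apply: continuous_addr; first apply: continuous_addr.
- by move=> y; exact: differentiable_continuous.
- apply: continuous_mulr; first exact: cc.
  apply: continuous_sumr => i; apply: continuous_sqrr.
  by apply: continuous_subr; [exact: coord_continuous|exact: cc].
- apply: continuous_mulr; first exact: cc.
  apply: continuous_addr; apply: continuous_sumr => i; apply: continuous_sqrr.
    by move=> y; exact: differentiable_continuous.
  apply: continuous_maxr; last exact: cc.
  by move=> y; exact: differentiable_continuous.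
Qed.

(** The positive part in [penal] is never differentiated: since
    [(max s 0)^2 <= (max t 0 + (s - t))^2], with equality for [s = t], a local
    minimiser [x] of [penal] also minimises the function [M] obtained with
    [t = G j x], which is differentiable. *)
Lemma penalty_stationary k x a : 0 < a ->
  (forall y, `|x - y| < a -> penal k x <= penal k y) ->
  forall v, 'D_v phi x + \sum_i (x 0 i - xb 0 i) * v 0 i +
    k%:R * (\sum_l H l x * 'D_v (H l) x +
            \sum_j Num.max (G j x) 0 * 'D_v (G j) x) = 0.
Proof.
move=> a0 xmin v.
pose c j := Num.max (G j x) 0 - G j x.
pose M y := phi y + 2^-1 * prox y +
  k%:R / 2 * (\sum_l H l y ^+ 2 + \sum_j (c j + G j y) ^+ 2).
have dM z : is_derive z v M ('D_v phi z +
    2^-1 * (\sum_i 2 * (z 0 i - xb 0 i) * v 0 i) +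
    k%:R / 2 * (\sum_l 2 * H l z * 'D_v (H l) z +
      \sum_j 2 * (c j + G j z) * 'D_v (G j) z)).
  apply: is_deriveD; first apply: is_deriveD.
  - exact/derivableP/diff_derivable.
  - apply: is_deriveZ; apply: is_derive_bigsum => i; apply: is_derive_sqr.
    rewrite (_ : (fun y : 'rV[R]_n => _) = fun y => - xb 0 i + y 0 i).
      exact/is_derive_cstD/is_derive_coord.
    by apply/funext => y; rewrite addrC.
  apply: is_deriveZ; apply: is_deriveD; apply: is_derive_bigsum => i;
    apply: is_derive_sqr.
    exact/derivableP/diff_derivable.
  exact/is_derive_cstD/derivableP/diff_derivable.
have Mx : M x = penal k x.
  rewrite /M /penal /infeas; congr (_ + _ * (_ + _)).
  by apply: eq_bigr => j _; rewrite /c subrK.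
have penalM y : penal k y <= M y.
  rewrite lerD2l ler_wpM2l ?divr_ge0// lerD2l; apply: ler_sum => j _.
  rewrite /c; move: (G j y) (G j x) => s t.
  case: (lerP s 0) => s0; case: (lerP t 0) => t0.
  - by rewrite expr0n sqr_ge0.
  - by rewrite expr0n sqr_ge0.
  - by rewrite lerXn2r ?nnegrE ?sub0r ?lerDr ?oppr_ge0 ?addr_ge0 ?oppr_ge0// ltW.
  - by rewrite subrr add0r.
have : 'D_v M x = 0.
  apply: (derive_local_min a0) => [y|y /xmin].
    exact: (@ex_derive _ _ _ _ _ _ _ (dM y)).
  by rewrite Mx => /le_trans; apply.
rewrite (@derive_val _ _ _ _ _ _ _ (dM x)) => M0; rewrite -[RHS]M0.
congr (_ + _ + _).
  by rewrite mulr_sumr; apply: eq_bigr => i _; field.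
rewrite [LHS]mulrDr [RHS]mulrDr !mulr_sumr.
congr (_ + _); apply: eq_bigr => i _; first by field.
by rewrite /c subrK; field.
Qed.

(** For large [k] the penalty exceeds [phi xb = penal k xb] on the sphere of
    radius [e]: otherwise Cantor's theorem gives a feasible point [y] of the
    sphere with [phi y + prox y / 2 <= phi xb], against the minimality of [xb].
    So [penal k] has an interior minimiser on the ball, where the only error
    term is [x - xb]. *)
Lemma approx_stationary e : 0 < e ->
  (forall l, H l xb = 0) -> (forall j, G j xb <= 0) ->
  (forall y, `|xb - y| <= e -> (forall l, H l y = 0) ->
    (forall j, G j y <= 0) -> phi xb <= phi y) ->
  exists (x : 'rV[R]_n) (k : nat), `|xb - x| < e /\
    forall i, `|'D_(delta_mx 0 i) phi x +
      k%:R * (\sum_l H l x * 'D_(delta_mx 0 i) (H l) x +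
        \sum_j Num.max (G j x) 0 * 'D_(delta_mx 0 i) (G j) x)| < e.
Proof.
move=> e0 Hxb Gxb xbmin.
have infeasxb : infeas xb = 0.
  rewrite /infeas !big1 ?addr0// => i _; last by rewrite Hxb expr0n.
  by rewrite (max_idPr (Gxb i)) expr0n.
have proxxb : prox xb = 0.
  by rewrite /prox big1// => i _; rewrite subrr expr0n.
have penalxb k : penal k xb = phi xb.
  by rewrite /penal infeasxb proxxb !mulr0 !addr0.
have cN : continuous (fun y : 'rV[R]_n => `|xb - y|).
  exact: continuous_dist.
have [k kP] : exists k, forall y, `|xb - y| = e -> phi xb < penal k y.
  apply: contrapT => /forallNP nk.
  pose F k := [set y | `|xb - y| = e] `&` [set y | penal k y <= phi xb].
  have [||||y yP] := @nested_closed_nonempty _ _ F (`|xb| + e).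
  - move=> k; apply: closedI; last exact: closed_sublevel.
    rewrite (_ : [set y | _] = (fun y => `|xb - y|) @^-1` [set e]) //.
    by apply: closed_comp => [y _|]; [exact: cN|exact: closed_eq].
  - move=> k y [ye /= yk]; split => //=; apply: le_trans yk.
    by rewrite lerD2l ler_wpM2r// ler_wpM2r// ler_nat.
  - move=> k; have /existsNP[y /not_implyP[ye /negP]] := nk k.
    by rewrite -leNgt => yk; exists y.
  - move=> y [/= ye _]; rewrite -[y](subKr xb).
    by apply: le_trans (ler_normB _ _) _; rewrite ye.
  have [/= ye _] := yP 0%N.
  have y0 : infeas y = 0.
    apply/eqP; rewrite eq_le infeas_ge0 andbT leNgt; apply/negP => y0.
    pose K := Num.bound `|(phi xb - phi y) / (infeas y / 2)|.
    have := yP K => -[_ /=]; apply/negP; rewrite -ltNge.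
    have : (phi xb - phi y) / (infeas y / 2) < K%:R.
      exact: le_lt_trans (ler_norm _) (archi_boundP (normr_ge0 _)).
    rewrite ltr_pdivrMr ?divr_gt0// /penal => h.
    have := prox_ge0 y; move: h; set u := K%:R; set i := infeas y.
    lra.
  have : phi xb <= phi y.
    move: y0 => /eqP; rewrite paddr_eq0; last 2 first.
    - by apply: sumr_ge0 => i _; exact: sqr_ge0.
    - by apply: sumr_ge0 => i _; exact: sqr_ge0.
    do 2![rewrite psumr_eq0; last by move=> i _; exact: sqr_ge0].
    move=> /andP[/allP Hy /allP Gy]; apply: xbmin; first by rewrite ye.
      move=> l; have := Hy l; rewrite mem_index_enum sqrf_eq0.
      by move=> /(_ isT)/eqP.
    move=> j; have := Gy j; rewrite mem_index_enum sqrf_eq0.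
    by move=> /(_ isT)/eqP <-; rewrite le_max lexx.
  have : 0 < prox y.
    rewrite lt_neqAle prox_ge0 andbT eq_sym; apply/eqP => /eqP.
    rewrite psumr_eq0; last by move=> i _; exact: sqr_ge0.
    move=> /allP h; move: e0; rewrite -ye normr_gt0 subr_eq0 => /eqP; apply.
    apply/rowP => i; have := h i; rewrite mem_index_enum sqrf_eq0 subr_eq0.
    by move=> /(_ isT)/eqP.
  have [_ /=] := yP 0%N; rewrite /penal; lra.
pose B := [set y : 'rV[R]_n | `|xb - y| <= e].
have Bxb : B xb by rewrite /B /= subrr normr0 ltW.
have cB : compact B.
  apply: bounded_closed_compact; last exact: closed_sublevel.
  exists (`|xb| + e); split; first exact: num_real.
  move=> M /ltW h y By; apply: le_trans h; rewrite -[y](subKr xb).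
  by apply: le_trans (ler_normB _ _) _; rewrite lerD2l.
have [||x Bx xmin] := @EVT_min_rV _ _ (penal k) B _ cB.
- by exists xb.
- exact/continuous_subspaceT/penal_continuous.
rewrite inE /B /= in Bx.
have xe : `|xb - x| < e.
  rewrite lt_neqAle Bx andbT; apply/eqP => /kP.
  by have := xmin xb; rewrite inE penalxb => /(_ Bxb); rewrite leNgt => /negP.
exists x, k; split => // i.
have ex : 0 < e - `|xb - x| by rewrite subr_gt0.
have xmin' y : `|x - y| < e - `|xb - x| -> penal k x <= penal k y.
  move=> xy; apply: xmin; rewrite inE /B /= -[xb - y](subrKA x).
  by apply: le_trans (ler_normD _ _) _; rewrite -lerBrDl ltW.
have := penalty_stationary ex xmin' (delta_mx 0 i).
rewrite (bigD1 i)//= big1 ?addr0 => [|j ji]; last first.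
  by rewrite mxE eqxx/= (negbTE ji) mulr0.
rewrite mxE !eqxx mulr1; set a := 'D__ phi x; set b := k%:R * _ => st.
have -> : a + b = xb 0 i - x 0 i.
  by move: st; set u := x 0 i; set w := xb 0 i; lra.
apply: le_lt_trans xe; have := coord_le_mxnorm (xb - x) i.
by rewrite !mxE.
Qed.

End penalty.

End pointwise_penalty.

(** * Partial derivatives of the data *)

Section partial_derivatives.
Context {R : realType} d (X : measurableType d).
Implicit Types (D : set X) (n : nat).

(** A directional derivative is the limit of difference quotients along
    [1 / (k + 1)]. *)
Lemma measurable_derive D n (f : 'rV[R]_n -> X -> R) x v :
  (forall y, measurable_fun D (f y)) ->
  (forall t, D t -> derivable (f^~ t) x v) ->
  measurable_fun D (fun t => 'D_v (f^~ t) x).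
Proof.
move=> mf df.
pose q k (t : X) := k.+1%:R * (f (k.+1%:R^-1 *: v + x) t - f x t).
apply: (@measurable_fun_cvg _ _ _ D q) => [k|t Dt].
  by apply: measurable_funM => //; apply: measurable_funB.
have : (fun k : nat => k.+1%:R^-1 : R) @ \oo --> (0 : R)^'.
  move=> P [e e0 P0]; have h : (fun k : nat => k.+1%:R^-1 : R) @ \oo --> (0 : R).
    exact: cvg_harmonic.
  have /h [K _ KP] : nbhs (0 : R) (ball 0 e) by exact: nbhsx_ballx.
  by exists K => // k /= /KP kP; apply: P0.
move=> /cvg_comp/(_ (df t Dt)); rewrite /derive.
suff -> : q^~ t = (fun h => h^-1 *: (f (h *: v + x) t - f x t)) \o
    (fun k : nat => k.+1%:R^-1 : R) by [].
by apply/funext => k; rewrite /q /= invrK.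
Qed.

Lemma carath_derive D n (f : 'rV[R]_n -> X -> R) v :
  (forall y, measurable_fun D (f y)) ->
  (forall t, D t -> forall y, differentiable (f^~ t) y) ->
  (forall t, D t -> continuous ('D_v (f^~ t))) ->
  carath D (fun y t => 'D_v (f^~ t) y).
Proof.
move=> mf df cf; split => // y; apply: measurable_derive => // t Dt.
exact/diff_derivable/df.
Qed.

End partial_derivatives.

Section components.
Context {R : realType}.

Lemma coord_compE (T : Type) k (f : T -> 'rV[R]_k) i :
  (fun y => f y 0 i) = (fun w : 'rV[R]_k => w 0 i) \o f.
Proof. by []. Qed.

Lemma differentiable_coord_comp n k (f : 'rV[R]_n -> 'rV[R]_k) x i :
  differentiable f x -> differentiable (fun y => f y 0 i) x.
Proof.
move=> df; rewrite coord_compE; apply: differentiable_comp => //.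
exact: differentiable_coord.
Qed.

Lemma derive_coord n k (f : 'rV[R]_n -> 'rV[R]_k) x i v :
  differentiable f x -> 'D_v (fun y => f y 0 i) x = ('D_v f x) 0 i.
Proof.
move=> df; rewrite !deriveE//; last exact: differentiable_coord_comp.
rewrite coord_compE diff_comp//=; last exact: differentiable_coord.
rewrite -deriveE; last exact: differentiable_coord.
by rewrite (@derive_val _ _ _ _ _ _ _ (is_derive_coord (f x) _ i)).
Qed.

Lemma C1_derive_continuous n (f : 'rV[R]_n -> R) i :
  C1 f -> continuous ('D_(delta_mx 0 i) f).
Proof.
move=> [_ cf].
rewrite (_ : 'D_(_) f = (fun w : 'rV[R]_n => w 0 i) \o grad f).
  by move=> y; apply: continuous_comp; [exact: cf|exact: coord_continuous].
by apply/funext => y /=; rewrite mxE.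
Qed.

Lemma C1v_derive_continuous n k (f : 'rV[R]_n -> 'rV[R]_k) i l :
  C1v f -> continuous ('D_(delta_mx 0 l) (fun y => f y 0 i)).
Proof.
move=> [df cf].
rewrite (_ : 'D_(_) _ = (fun M : 'M[R]_(n, k) => M l i) \o (fun x => 'J f x)).
  by move=> y; apply: continuous_comp; [exact: cf|exact: coord_continuous].
apply/funext => y /=.
by rewrite derive_coord// deriveEjacobian// -rowE mxE.
Qed.

End components.

(** * Integration and full sets of times *)

Section integral_tools.
Local Open Scope ereal_scope.
Context {R : realType} d (X : measurableType d).
Variables (nu : {measure set X -> \bar R}) (D : set X).
Hypothesis mD : measurable D.

Lemma integrable_le (f G : X -> R) : measurable_fun D f ->
  (forall t, D t -> (`|f t| <= G t)%R) ->
  nu.-integrable D (fun t => (G t)%:E) -> nu.-integrable D (fun t => (f t)%:E).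
Proof.
move=> mf fG; apply: le_integrable => //; first exact/measurable_EFinP.
by move=> t Dt /=; rewrite lee_fin (le_trans (fG t Dt))// ler_norm.
Qed.

(** The difference [f - f'] is nonnegative with a nonpositive integral, so it
    vanishes almost everywhere. *)
Lemma null_of_integral_le (f f' : X -> R) (S : set X) :
  measurable S -> S `<=` D ->
  nu.-integrable D (fun t => (f t)%:E) -> nu.-integrable D (fun t => (f' t)%:E) ->
  \int[nu]_(t in D) (f t)%:E <= \int[nu]_(t in D) (f' t)%:E ->
  (forall t, D t -> (f' t <= f t)%R) -> (forall t, S t -> (f' t < f t)%R) ->
  nu S = 0.
Proof.
move=> mS SD fi f'i le_int f'f f'fS.
have ffi := integrableB mD fi f'i.
have abs0 : \int[nu]_(t in D) `|(f t)%:E - (f' t)%:E| = 0.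
  rewrite (eq_integral (fun t => (f t)%:E - (f' t)%:E)); last first.
    by move=> t /set_mem Dt; rewrite gee0_abs// -EFinB lee_fin subr_ge0 f'f.
  apply/eqP; rewrite eq_le integral_ge0 ?andbT; last first.
    by move=> t Dt; rewrite -EFinB lee_fin subr_ge0 f'f.
  by rewrite integralB// sube_le0.
have := (ae_eq_integral_abs nu mD (measurable_int _ ffi)).1 abs0.
move=> [N [mN N0 DN]]; apply: (subset_measure0 _ mN _ N0) => //.
move=> t St; apply: DN => /= /(_ (SD _ St))/eqP.
by rewrite -EFinB eqe subr_eq0 => /eqP ff; have := f'fS _ St; rewrite ff ltxx.
Qed.

Lemma integrable_scaleD (a : R) (f f' : X -> R) :
  nu.-integrable D (fun t => (f t)%:E) -> nu.-integrable D (fun t => (f' t)%:E) ->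
  nu.-integrable D (fun t => (a * f t + f' t)%:E).
Proof. by move=> fi fi'; have := integrableD mD (integrableZl mD a fi) fi'. Qed.

Lemma dominated_to0 (f : nat -> X -> R) (G : X -> R) :
  (forall N, measurable_fun D (f N)) ->
  (forall t, D t -> f ^~ t @ \oo --> (0 : R)%R) ->
  (forall N t, D t -> (0 <= f N t <= G t)%R) ->
  nu.-integrable D (fun t => (G t)%:E) ->
  (fun N => \int[nu]_(t in D) (f N t)%:E) @ \oo --> 0.
Proof.
move=> mf f0 fG Gi.
have [|||||_ _] := @dominated_convergence _ _ _ nu D mD
    (fun N t => (f N t)%:E) (cst 0) (fun t => (G t)%:E).
- by move=> N; exact/measurable_EFinP.
- exact: measurable_cst.
- by apply: aeW => t Dt; apply: cvg_EFin; [exact: nearW|exact: f0].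
- exact: Gi.
- by apply: aeW => t N Dt; have /andP[? ?] := fG N t Dt; rewrite gee0_abs lee_fin.
- by rewrite integral0.
Qed.

End integral_tools.

Section full_sets.
Context {R : realType}.
Implicit Types (T : R) (D : set (lebT R)).

Lemma measurable_itv0 T : measurable (`[0, T]%classic : set (lebT R)).
Proof. by apply: sub_caratheodory; exact: measurable_itv. Qed.

(** Statements about almost every time are turned into statements about every
    time of one measurable set, on which functions can be combined freely. *)
Definition full T D :=
  [/\ measurable D, D `<=` `[0, T]%classic & leb (`[0, T]%classic `\` D) = 0%E].

Lemma ae_on_full T (Q : R -> Prop) : ae_on T Q ->
  exists2 D, full T D & forall t, D t -> Q t.
Proof.
move=> [N [mN N0 QN]]; exists (`[0, T]%classic `\` N).
  split; first by apply: measurableD => //; exact: measurable_itv0.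
    exact: subDsetl.
  apply: (@subset_measure0 _ _ _ leb _ N) => //.
    apply: measurableD; first exact: measurable_itv0.
    by apply: measurableD => //; exact: measurable_itv0.
  by move=> t [t0]; apply: contra_notP => tN.
move=> t [t0 tN]; apply: contrapT => nQ; apply: tN; apply: QN => /= h.
exact/nQ/h.
Qed.

Lemma full_ae_on T D (Q : R -> Prop) :
  full T D -> (forall t, D t -> Q t) -> ae_on T Q.
Proof.
move=> [mD _ D0] DQ; exists (`[0, T]%classic `\` D); split => //.
  by apply: measurableD => //; exact: measurable_itv0.
move=> t /= /not_implyP[t0 nQ]; split => // /DQ.
exact: nQ.
Qed.

Lemma ae_onI T (P Q : R -> Prop) : ae_on T P -> ae_on T Q ->
  ae_on T (fun t => P t /\ Q t).
Proof.
apply: (@filterS2 _ _ (ae_filter_ringOfSetsType leb)) => t hP hQ t0.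
by split; [exact: hP|exact: hQ].
Qed.

Lemma ae_onS T (P Q : R -> Prop) : (forall t, P t -> Q t) -> ae_on T P ->
  ae_on T Q.
Proof.
move=> PQ.
by apply: (@filterS _ _ (ae_filter_ringOfSetsType leb)) => t hP /hP/PQ.
Qed.

Lemma full_setDD T D : full T D ->
  `[0, T]%classic `\` (`[0, T]%classic `\` D) = D.
Proof. by move=> [_ D1 _]; rewrite setDD; exact: setIidr. Qed.

Lemma full_measurableN T D : full T D ->
  measurable (`[0, T]%classic `\` D : set (lebT R)).
Proof. by move=> [mD _ _]; apply: measurableD => //; exact: measurable_itv0. Qed.

Lemma lmeasurable_full T D (f : R -> R) : full T D ->
  lmeasurable T f -> measurable_fun D (f : lebT R -> R).
Proof.
move=> [mD DT _]; apply: measurable_funS => //; exact: measurable_itv0.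
Qed.

(** Completeness of the measure: values on a null set do not matter. *)
Lemma full_lmeasurable T D (f : R -> R) : full T D ->
  measurable_fun D (f : lebT R -> R) -> lmeasurable T f.
Proof.
move=> fD mf _ B mB; have [mD DT D0] := fD.
rewrite -(setDUK DT) setIUl; apply: measurableU; first exact: mf.
apply: completed_lebesgue_measure_is_complete.
exists (`[0, T]%classic `\` D); split.
- exact: full_measurableN.
- exact: D0.
- by move=> t [].
Qed.

Lemma integrable_full T D (f : R -> R) : full T D ->
  measurable_fun D (f : lebT R -> R) ->
  lintegrable T f <-> leb.-integrable D (fun t => (f t)%:E).
Proof.
move=> fD mf; have := full_measurableN fD => mN.
have mTf : measurable_fun (`[0, T]%classic : set (lebT R)) (fun t => (f t)%:E).
  by apply/measurable_EFinP; exact: full_lmeasurable fD mf.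
have [_ _ D0] := fD; rewrite -(full_setDD fD).
exact: (negligible_integrable mN (measurable_itv0 T) mTf D0).
Qed.

Lemma integral_full T D (f : R -> R) : full T D -> lintegrable T f ->
  (\int[leb]_(t in `[0%R, T]) (f t)%:E = \int[leb]_(t in D) (f t)%:E)%E.
Proof.
move=> fD mf; have := full_measurableN fD => mN.
have [_ _ D0] := fD; rewrite -[in RHS](full_setDD fD).
exact: (negligible_integral mN (measurable_itv0 T) mf D0).
Qed.

Lemma lintegrable_le T D (f G : R -> R) : full T D ->
  measurable_fun D (f : lebT R -> R) -> lintegrable T G ->
  (forall t, D t -> `|f t| <= G t) -> lintegrable T f.
Proof.
move=> fD mf GT fG; have [mD _ _] := fD.
have mG : measurable_fun D (G : lebT R -> R).
  apply: lmeasurable_full fD _.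
  by have /integrableP[/measurable_EFinP] := GT.
apply/(integrable_full fD mf); apply: (integrable_le mD mf fG).
exact: (integrable_full fD mG).1 GT.
Qed.

Lemma Linf_full T D k (u : R -> 'rV[R]_k) M : full T D ->
  measurable_rV D (u : lebT R -> _) -> (forall t, D t -> enorm (u t) <= M) ->
  Linf T u.
Proof.
move=> fD mu uM; split; first by move=> i; exact: full_lmeasurable fD (mu i).
by exists M; exact: full_ae_on fD uM.
Qed.

Lemma Linf_close T D k (u w : R -> 'rV[R]_k) M : full T D -> Linf T u ->
  measurable_rV D (w : lebT R -> _) ->
  (forall t, D t -> enorm (w t - u t) <= M) -> Linf T w.
Proof.
move=> fD [_ [M' uM']] mw wM.
split; first by move=> i; exact: full_lmeasurable fD (mw i).
exists (k%:R * (M' + M)).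
have := ae_onI uM' (full_ae_on fD wM); apply: ae_onS => t [tM' tM].
apply: (le_trans (enorm_le_mxnorm _)).
rewrite ler_wpM2l// -[w t](subrKC (u t)) (le_trans (ler_normD _ _))// lerD//.
  exact: le_trans (mxnorm_le_enorm _) tM'.
exact: le_trans (mxnorm_le_enorm _) tM.
Qed.

Lemma weak_L1_of_norm T k (fs : nat -> R -> 'rV[R]_k) (f : R -> 'rV[R]_k) :
  (forall N, L1 T (fs N)) -> L1 T f ->
  (fun N => L1norm T (fun t => - 1 *: f t + fs N t)) @ \oo --> 0%E ->
  weak_L1 T fs f.
Proof.
move=> fsL fL cv l [lin [C lC]].
pose dif N (t : R) := - 1 *: f t + fs N t.
have dL N : L1 T (dif N).
  move=> i; have := integrable_scaleD (measurable_itv0 T) (- 1) (fL i) (fsL N i).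
  by apply: eq_integrable; [exact: measurable_itv0|move=> t _; rewrite !mxE].
have /fine_cvgP[fin /cvgrPdist_lt cvf] :
    (fun N => C%:E * L1norm T (dif N))%E @ \oo --> 0%E.
  by rewrite -(mule0 C%:E); exact: cvgeZl.
apply/cvgrPdist_lt => e e0; near=> N.
have : (`|l (dif N)|%:E <= (fine (C%:E * L1norm T (dif N)))%:E)%E.
  by rewrite fineK; [exact: lC|near: N].
rewrite lee_fin /dif lin// mulN1r addrC distrC => /le_lt_trans; apply.
have : `|0 - fine (C%:E * L1norm T (dif N))%E| < e.
  by near: N; exact: cvf.
by rewrite sub0r normrN; apply: le_lt_trans; exact: ler_norm.
Unshelve. all: by end_near. Qed.

End full_sets.

(** * The data of the problem *)

Section problem_data.
Context {R : realType}.
Variables (T : R) (n p m : nat) (phi : 'rV[R]_n -> R -> R)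
  (h : 'rV[R]_n -> R -> 'rV[R]_p) (g : 'rV[R]_n -> R -> 'rV[R]_m)
  (xbar : R -> 'rV[R]_n) (D : set (lebT R)).

(** What (H1), (H2) and feasibility give at every time of a full set [D],
    together with measurability in time. *)
Record nice_data : Prop := NiceData {
  nice_full : full T D ;
  nice_C1 : forall t, D t -> C1 (phi^~ t) ;
  nice_C1v : forall t, D t -> C1v ((hg h g)^~ t) ;
  nice_mphi : forall x, lmeasurable T (phi x) ;
  nice_mhg : forall x i, lmeasurable T (fun t => hg h g x t 0 i) ;
  nice_Linf : Linf T xbar ;
  nice_eq : forall t, D t -> h (xbar t) t = 0 ;
  nice_le : forall t, D t -> forall j, g (xbar t) t 0 j <= 0 }.

Hypothesis nd : nice_data.

Let fD := nice_full nd.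

Let mD : measurable D. Proof. by case: fD. Qed.

Lemma hg_lshift l y t : hg h g y t 0 (lshift m l) = h y t 0 l.
Proof. by rewrite /hg row_mxEl. Qed.

Lemma hg_rshift j y t : hg h g y t 0 (rshift p j) = g y t 0 j.
Proof. by rewrite /hg row_mxEr. Qed.

Lemma measurable_xbar : measurable_rV D (xbar : lebT R -> _).
Proof. by move=> i; apply: lmeasurable_full fD _; exact: (nice_Linf nd).1. Qed.

Lemma differentiable_phi t y : D t -> differentiable (phi^~ t) y.
Proof. by move=> Dt; exact: (nice_C1 nd Dt).1. Qed.

Lemma carath_phi : carath D (phi : _ -> lebT R -> R).
Proof.
split => [y|t Dt y].
  exact: lmeasurable_full fD (nice_mphi nd y).
exact/differentiable_continuous/differentiable_phi.
Qed.

Lemma carath_dphi i :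
  carath D (fun y (t : lebT R) => 'D_(delta_mx 0 i) (phi^~ t) y).
Proof.
apply: carath_derive => [y|t Dt y|t Dt].
- exact: carath_phi.1.
- exact: differentiable_phi.
- exact/C1_derive_continuous/(nice_C1 nd).
Qed.

Lemma differentiable_hg i t y : D t ->
  differentiable (fun y => hg h g y t 0 i) y.
Proof.
by move=> Dt; apply: differentiable_coord_comp; exact: (nice_C1v nd Dt).1.
Qed.

Lemma carath_hg i : carath D (fun y (t : lebT R) => hg h g y t 0 i).
Proof.
split => [y|t Dt y].
  exact: lmeasurable_full fD (nice_mhg nd y i).
by apply: differentiable_continuous; exact: differentiable_hg.
Qed.

Lemma carath_dhg l i : carath D (fun y (t : lebT R) =>
  'D_(delta_mx 0 i) (fun y => hg h g y t 0 l) y).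
Proof.
apply: (@carath_derive _ _ _ _ _ (fun y (t : lebT R) => hg h g y t 0 l))
  => [y|t Dt y|t Dt].
- exact: (carath_hg _).1.
- exact: differentiable_hg.
- exact/C1v_derive_continuous/(nice_C1v nd).
Qed.

Lemma differentiable_h l t y : D t -> differentiable (fun y => h y t 0 l) y.
Proof.
move=> Dt; have := differentiable_hg (lshift m l) y Dt.
by under eq_fun do rewrite hg_lshift.
Qed.

Lemma differentiable_g j t y : D t -> differentiable (fun y => g y t 0 j) y.
Proof.
move=> Dt; have := differentiable_hg (rshift p j) y Dt.
by under eq_fun do rewrite hg_rshift.
Qed.

Lemma carath_h l : carath D (fun y (t : lebT R) => h y t 0 l).
Proof.
have := carath_hg (lshift m l).
rewrite (_ : (fun y t => _) = fun y (t : lebT R) => h y t 0 l)//.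
by apply/funext => y; apply/funext => t; exact: hg_lshift.
Qed.

Lemma carath_g j : carath D (fun y (t : lebT R) => g y t 0 j).
Proof.
have := carath_hg (rshift p j).
rewrite (_ : (fun y t => _) = fun y (t : lebT R) => g y t 0 j)//.
by apply/funext => y; apply/funext => t; exact: hg_rshift.
Qed.

Lemma carath_dh l i : carath D (fun y (t : lebT R) =>
  'D_(delta_mx 0 i) (fun y => h y t 0 l) y).
Proof.
have := carath_dhg (lshift m l) i; congr carath.
apply/funext => y; apply/funext => t; congr ('D__ _ _).
by apply/funext => z; exact: hg_lshift.
Qed.

Lemma carath_dg j i : carath D (fun y (t : lebT R) =>
  'D_(delta_mx 0 i) (fun y => g y t 0 j) y).
Proof.
have := carath_dhg (rshift p j) i.
rewrite (_ : (fun y t => _) = fun y (t : lebT R) =>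
  'D_(delta_mx 0 i) (fun y => g y t 0 j) y)//.
apply/funext => y; apply/funext => t; congr ('D__ _ _).
by apply/funext => z; exact: hg_rshift.
Qed.

End problem_data.
(** * Local optimality is pointwise *)

Section pointwise_optimality.
Context {R : realType}.
Variables (T : R) (n p m : nat) (phi : 'rV[R]_n -> R -> R)
  (h : 'rV[R]_n -> R -> 'rV[R]_p) (g : 'rV[R]_n -> R -> 'rV[R]_m)
  (xbar : R -> 'rV[R]_n) (D : set (lebT R)) (c : R -> R) (r r' delta : R).
Hypotheses (nd : nice_data T phi h g xbar D)
  (c_int : lintegrable T c)
  (phi_int : lintegrable T (fun t => `|phi (xbar t) t|))
  (phi_lip : forall t, D t -> forall x y,
    enorm (x - xbar t) <= r -> enorm (y - xbar t) <= r ->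
    `|phi x t - phi y t| <= c t * enorm (x - y))
  (delta_gt0 : 0 < delta) (delta_r : delta <= r) (delta_r' : delta < r')
  (opt : forall x, feasible T h g x ->
    ae_on T (fun t => enorm (x t - xbar t) < r') ->
    (cost T phi xbar <= cost T phi x)%E).

Let fD := nice_full nd.

Let mD : measurable D. Proof. by case: fD. Qed.

(** The sublevel [gap k y t <= 0] says that [xbar t + y] is feasible at time
    [t], [delta]-close to [xbar t] and better by [1 / (k + 1)]. *)
Let gap k (y : 'rV[R]_n) (t : lebT R) : R :=
  Num.max (enorm y - delta)
  (Num.max (\sum_l `|h (xbar t + y) t 0 l|)
  (Num.max (\sum_j Num.max (g (xbar t + y) t 0 j) 0)
    (phi (xbar t + y) t + (k.+1%:R^-1 - phi (xbar t) t)))).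

Let gapP k y t : gap k y t <= 0 <->
  [/\ enorm y <= delta, h (xbar t + y) t = 0,
      forall j, g (xbar t + y) t 0 j <= 0 &
      phi (xbar t + y) t + k.+1%:R^-1 <= phi (xbar t) t].
Proof.
rewrite /gap !ge_max subr_le0; split.
  move=> /and4P[-> h0 g0 p0]; split => //.
  - apply/rowP => l; rewrite mxE; apply/eqP; rewrite -normr_le0.
    by apply: le_trans h0; rewrite (bigD1 l)//= lerDl sumr_ge0.
  - move=> j; apply: le_trans g0; rewrite (bigD1 j)//=.
    rewrite (@le_trans _ _ (Num.max (g (xbar t + y) t 0 j) 0))//.
      by rewrite le_max lexx.
    by rewrite lerDl sumr_ge0// => i _; rewrite le_max lexx orbT.
  - by move: p0; rewrite addrA subr_le0.
move=> [-> h0 g0 p0]; apply/and4P; split => //.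
- by rewrite big1// => l _; rewrite h0 mxE normr0.
- by rewrite big1// => j _; exact/max_idPr.
- by rewrite addrA subr_le0.
Qed.

Let measurable_phi_xbar : measurable_fun D (fun t : lebT R => phi (xbar t) t).
Proof.
exact: measurable_carath mD (carath_phi nd) (measurable_xbar nd).
Qed.

Let carath_gap k : carath D (gap k).
Proof.
have mx := measurable_xbar nd.
apply: carath_max.
  apply: (carath_fixed D (a := fun y => enorm y - delta)).
  apply: continuous_subr; last exact: cst_continuous.
  by apply: continuous_enorm => j; exact: coord_continuous.
apply: carath_max.
  apply: carath_sum => l.
  exact: carath_norm (carath_shift mD (carath_h nd l) mx).
apply: carath_max.
  apply: carath_sum => j.
  apply: (carath_max (carath_shift mD (carath_g nd j) mx)).
  exact/carath_cst/measurable_cst.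
apply: (carathD (carath_shift mD (carath_phi nd) mx)).
by apply: carath_cst; apply: measurable_funB.
Qed.

Let coercive_gap k : coercive D delta (gap k).
Proof.
move=> t Dt y; rewrite -lerBlDl /gap le_max.
by apply/orP; left.
Qed.

Let improvable k := D `&` [set t | exists y, gap k y t <= 0].

Let measurable_improvable k : measurable (improvable k).
Proof. exact: measurable_solvable mD (carath_gap k) (@coercive_gap k). Qed.

(** Jumping from [xbar] to a measurably selected better point on
    [improvable k] would decrease the cost if that set were not null. *)
Let improvable_null k : leb (improvable k) = 0%E.
Proof.
have mx := measurable_xbar nd.
have mS := measurable_improvable k.
have SD : improvable k `<=` D by move=> t [].
have [z [mz zP]] := measurable_selection mD (carath_gap k) (@coercive_gap k).
rewrite -/(improvable k) in mz.
pose x (t : R) := if `[< improvable k t >] then xbar t + z t else xbar t.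
have xS t : improvable k t -> x t = xbar t + z t by move=> St; rewrite /x asboolT.
have xNS t : ~ improvable k t -> x t = xbar t by move=> St; rewrite /x asboolF.
have mxx : measurable_rV D (x : lebT R -> _).
  apply: (measurable_rV_patch mD mS SD _ mx).
  exact: measurable_rVD (measurable_rVS mD SD mx) mz.
have zle t : improvable k t -> enorm (z t) <= delta.
  by move=> [Dt St]; have /gapP[] := zP t Dt St.
have xle t : D t -> enorm (x t - xbar t) <= delta.
  move=> Dt; have [St|St] := pselect (improvable k t).
    by rewrite xS// addrC addKr zle.
  by rewrite xNS// subrr enorm0 ltW.
have feasx : feasible T h g x.
  split; last first.
    apply: full_ae_on fD _ => t Dt.
    have [St|St] := pselect (improvable k t); last first.
      by rewrite xNS//; split; [exact: nice_eq nd t Dt|exact: nice_le nd t Dt].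
    by rewrite xS//; have /gapP[_ ? ?] := zP t St.1 St.2.
  exact: Linf_close fD (nice_Linf nd) mxx xle.
have mphix : measurable_fun D (fun t : lebT R => phi (x t) t).
  exact: measurable_carath mD (carath_phi nd) mxx.
have i0 : leb.-integrable D (fun t : lebT R => (phi (xbar t) t)%:E).
  have mn : measurable_fun D (fun t : lebT R => `|phi (xbar t) t|).
    exact: measurableT_comp (@normr_measurable R setT) measurable_phi_xbar.
  exact: (integrable_le mD measurable_phi_xbar _ ((integrable_full fD mn).1 phi_int)).
have i1 : leb.-integrable D (fun t : lebT R => (phi (x t) t)%:E).
  have mc : measurable_fun D (c : lebT R -> R).
    apply: lmeasurable_full fD _.
    by have /integrableP[/measurable_EFinP] := c_int.
  have ic := (integrable_full fD mc).1 c_int.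
  have := integrableD mD (integrable_abse i0) (integrableZl mD delta (integrable_abse ic)).
  apply: (integrable_le mD (G := fun t => `|phi (xbar t) t| + delta * `|c t|) mphix).
  move=> t Dt; rewrite -[X in `|X| <= _](subrKC (phi (xbar t) t)).
  apply: (le_trans (ler_normD _ _)); rewrite lerD2l.
  have xt := xle t Dt; have ct := ler_norm (c t); have x0 := enorm_ge0 (x t - xbar t).
  have : `|phi (x t) t - phi (xbar t) t| <= c t * enorm (x t - xbar t).
    apply: (phi_lip Dt); first exact: le_trans xt delta_r.
    by rewrite subrr enorm0 (le_trans _ delta_r)// ltW.
  move=> /le_trans; apply; rewrite mulrC.
  apply: (@le_trans _ _ (enorm (x t - xbar t) * `|c t|)); first exact: ler_wpM2l.
  exact: ler_wpM2r.
apply: (null_of_integral_le mD mS SD i0 i1).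
- rewrite -(integral_full fD ((integrable_full fD measurable_phi_xbar).2 i0)).
  rewrite -(integral_full fD ((integrable_full fD mphix).2 i1)).
  apply: opt feasx _; apply: full_ae_on fD _ => t Dt.
  exact: le_lt_trans (xle t Dt) delta_r'.
- move=> t Dt; have [St|St] := pselect (improvable k t); last by rewrite xNS.
  rewrite xS//; have /gapP[_ _ _] := zP t St.1 St.2.
  by apply: le_trans; rewrite lerDl.
- move=> t St; rewrite xS//; have /gapP[_ _ _] := zP t St.1 St.2.
  by apply: lt_le_trans; rewrite ltrDl.
Qed.

(** A better feasible point at time [t] is better by at least [1 / (k + 1)] for
    some [k], so the exceptional times lie in countably many null sets. *)
Lemma pointwise_optimal : ae_on T (fun t => forall y,
  enorm (y - xbar t) <= delta -> h y t = 0 -> (forall j, g y t 0 j <= 0) ->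
  phi (xbar t) t <= phi y t).
Proof.
have nul : leb.-negligible (\bigcup_k improvable k).
  apply: negligible_bigcup => k; exists (improvable k).
  by split; [exact: measurable_improvable|exact: improvable_null|].
have [N [mN N0 SN]] := nul.
have [_ _ D0] := fD; have mDN := full_measurableN fD.
exists (N `|` (`[0, T]%classic `\` D)); split.
- exact: measurableU mN mDN.
- by apply: null_set_setU.
move=> t /= /not_implyP[t0 nopt].
have [Dt|] := pselect (D t); last by right.
left; apply: SN; move: nopt => /existsNP
  [y /not_implyP[yd /not_implyP[hy /not_implyP[gy /negP]]]].
rewrite -ltNge -subr_gt0 => /invSn_lt[k kP]; exists k => //; split => //.
exists (y - xbar t); apply/gapP; rewrite subrKC; split => //.
by rewrite addrC -lerBrDr ltW.
Qed.

End pointwise_optimality.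
(** * Measurable approximate multipliers *)

Section running_best.
Context {R : realType} (X A : Type) (I : countType).
Variables (cost : A -> X -> R) (cand : I -> X -> A) (start : X -> A).

(** Comparing one new candidate at a time lets measurability, and any property
    stable under measurable patching, pass along by induction. *)
Fixpoint running_best (N : nat) : X -> A :=
  if N is N'.+1 then
    if unpickle N' is Some i then
      fun t => if cost (cand i t) t < cost (running_best N' t) t
               then cand i t else running_best N' t
    else running_best N'
  else start.

Lemma running_best_ind (P : (X -> A) -> Prop) : P start ->
  (forall w i, P w ->
    P (fun t => if cost (cand i t) t < cost (w t) t then cand i t else w t)) ->
  forall N, P (running_best N).
Proof.
by move=> P0 PS; elim=> [|N ih] //=; case: unpickle => // i; exact: PS.
Qed.

Lemma cost_running_bestS N t :
  cost (running_best N.+1 t) t <= cost (running_best N t) t.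
Proof. by rewrite /=; case: unpickle => // i; case: ifP => // /ltW. Qed.

Lemma cost_running_best_cand i N t : (pickle i < N)%N ->
  cost (running_best N t) t <= cost (cand i t) t.
Proof.
elim: N => // N ih; rewrite ltnS leq_eqVlt => /orP[/eqP <-|/ih]; last first.
  exact: le_trans (cost_running_bestS N t).
by rewrite /= pickleK; case: ltP.
Qed.

Lemma cost_running_best_start N t :
  cost (running_best N t) t <= cost (start t) t.
Proof.
by elim: N => // N; exact: le_trans (cost_running_bestS N t).
Qed.

End running_best.

Section approximate_multipliers.
Context {R : realType}.
Variables (T : R) (n p m : nat) (phi : 'rV[R]_n -> R -> R)
  (h : 'rV[R]_n -> R -> 'rV[R]_p) (g : 'rV[R]_n -> R -> 'rV[R]_m)
  (xbar : R -> 'rV[R]_n) (D : set (lebT R)) (r delta : R).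
Hypotheses (nd : nice_data T phi h g xbar D)
  (r_gt0 : 0 < r) (delta_gt0 : 0 < delta)
  (xbar_min : forall t, D t -> forall y, enorm (y - xbar t) <= delta ->
    h y t = 0 -> (forall j, g y t 0 j <= 0) -> phi (xbar t) t <= phi y t).

Let fD := nice_full nd.

Let mD : measurable D. Proof. by case: fD. Qed.

Lemma mult_sumE x t (u : 'rV[R]_p) (v : 'rV[R]_m) i :
  mult_sum h g x t u v 0 i =
  \sum_l u 0 l * 'D_(delta_mx 0 i) (fun y => h y t 0 l) x +
  \sum_j v 0 j * 'D_(delta_mx 0 i) (fun y => g y t 0 j) x.
Proof.
rewrite /mult_sum mxE !summxE; congr (_ + _); apply: eq_bigr => l _;
  by rewrite !mxE.
Qed.

Lemma measurable_mult_sum (x : lebT R -> 'rV[R]_n) (u : lebT R -> 'rV[R]_p)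
    (v : lebT R -> 'rV[R]_m) :
  measurable_rV D x -> measurable_rV D u -> measurable_rV D v ->
  measurable_rV D (fun t => mult_sum h g (x t) t (u t) (v t)).
Proof.
move=> mx mu mv i; under eq_fun do rewrite mult_sumE.
apply: measurable_funD; apply: measurable_sumM => l.
- exact: mu.
- exact: measurable_carath mD (carath_dh nd l i) mx.
- exact: mv.
- exact: measurable_carath mD (carath_dg nd l i) mx.
Qed.

Lemma measurable_grad_phi :
  measurable_rV D (fun t : lebT R => grad (phi^~ t) (xbar t)).
Proof.
move=> i; under eq_fun do rewrite mxE.
exact: measurable_carath mD (carath_dphi nd i) (measurable_xbar nd).
Qed.

(** A point with a pair of multipliers, for [h] and for [g]. *)
Local Notation triple := ('rV[R]_n * 'rV[R]_p * 'rV[R]_m)%type.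
Local Notation pt w := (w.1.1).
Local Notation eqm w := (w.1.2).
Local Notation inm w := (w.2).

(** Controls both the point and the multiplier sum of a triple. The gradient of
    [phi] is taken at [xbar t], not at the point of the triple, so that the limit
    of the multiplier sums is read off directly. *)
Definition defect (w : triple) (t : R) : R :=
  enorm (pt w - xbar t) +
  enorm (grad (phi^~ t) (xbar t) + mult_sum h g (pt w) t (eqm w) (inm w)).

(** The triples [(x, u, v)] for which [x] is in the neighbourhood of [xbar]
    and [(u, v)] witnesses membership in [M (x, 0)]. *)
Definition admissible (w : lebT R -> triple) : Prop :=
  [/\ measurable_rV D (fun t => pt (w t)), measurable_rV D (fun t => eqm (w t)),
      measurable_rV D (fun t => inm (w t)),
      exists M, forall t, D t -> enorm (eqm (w t)) <= M /\ enorm (inm (w t)) <= M &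
      forall t, D t -> enorm (pt (w t) - xbar t) < r /\
        forall j, inm (w t) 0 j * gminus g j (pt (w t)) t = 0 /\
                  0 <= inm (w t) 0 j].

Lemma measurable_defect w : admissible w ->
  measurable_fun D (fun t : lebT R => defect (w t) t).
Proof.
move=> [mx mu mv _ _]; apply: measurable_funD; apply: measurable_fun_enorm.
  exact: measurable_rVB mx (measurable_xbar nd).
exact: measurable_rVD measurable_grad_phi (measurable_mult_sum mx mu mv).
Qed.

Let measurable_proj_if k (f : triple -> 'rV[R]_k) b w1 w2 :
  measurable_fun D b -> measurable_rV D (fun t => f (w1 t)) ->
  measurable_rV D (fun t => f (w2 t)) ->
  measurable_rV D (fun t : lebT R => f (if b t then w1 t else w2 t)).
Proof.
move=> mb m1 m2; rewrite (_ : (fun t => _) =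
    fun t => if b t then f (w1 t) else f (w2 t)).
  exact: measurable_rV_if mD mb m1 m2.
by apply/funext => t; case: ifP.
Qed.

Lemma admissible_if b w1 w2 : measurable_fun D b ->
  admissible w1 -> admissible w2 ->
  admissible (fun t => if b t then w1 t else w2 t).
Proof.
move=> mb [mx1 mu1 mv1 [M1 M1P] a1] [mx2 mu2 mv2 [M2 M2P] a2]; split.
- exact: (measurable_proj_if (f := fun w => pt w) mb mx1 mx2).
- exact: (measurable_proj_if (f := fun w => eqm w) mb mu1 mu2).
- exact: (measurable_proj_if (f := fun w => inm w) mb mv1 mv2).
- exists (Num.max M1 M2) => t Dt; rewrite !le_max.
  by case: ifP => _; [have [-> ->] := M1P t Dt|have [-> ->] := M2P t Dt];
    rewrite ?orbT.
- by move=> t Dt; case: ifP => _; [exact: a1|exact: a2].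
Qed.

Definition trivial_triple (t : lebT R) : triple := (xbar t, 0, 0).

Lemma admissible_trivial : admissible trivial_triple.
Proof.
split.
- exact: measurable_xbar nd.
- exact: measurable_rV_cst.
- exact: measurable_rV_cst.
- by exists 0 => t _; rewrite !enorm0.
- by move=> t _; rewrite subrr enorm0; split => // j; rewrite mxE mul0r.
Qed.

Lemma defect_trivial t :
  defect (trivial_triple t) t = enorm (grad (phi^~ t) (xbar t)).
Proof.
rewrite /defect /= subrr enorm0 add0r; congr enorm.
apply/rowP => i; rewrite mxE mult_sumE !big1 ?addr0// => l _;
  by rewrite mxE mul0r.
Qed.

(** The multipliers that the penalty method with weight [k] assigns to [x]. *)
Definition penalty_triple (k : nat) (x : 'rV[R]_n) (t : lebT R) : triple :=
  (x, k%:R *: h x t, \row_j (k%:R * Num.max (g x t 0 j) 0)).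

(** The cut-off at [M] keeps the multipliers essentially bounded, although [h]
    and [g] are only bounded by integrable functions near [xbar]. *)
Definition candidate (i : nat * nat * nat) (t : lebT R) : triple :=
  let: (a, k, M) := i in
  let w := penalty_triple k (xbar t + rat_vec n a) t in
  if [&& enorm (rat_vec n a : 'rV[R]_n) < r, enorm (eqm w) <= M%:R
       & enorm (inm w) <= M%:R]
  then w else trivial_triple t.

Lemma measurable_penalty_triple k (x : lebT R -> 'rV[R]_n) :
  measurable_rV D x ->
  measurable_rV D (fun t => eqm (penalty_triple k (x t) t)) /\
  measurable_rV D (fun t => inm (penalty_triple k (x t) t)).
Proof.
move=> mx; split.
  apply: measurable_rVZ => l; exact: measurable_carath mD (carath_h nd l) mx.
apply: measurable_row => j; apply: measurable_pos_part.
exact: measurable_carath mD (carath_g nd j) mx.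
Qed.

(** Complementarity is exact: the positive and the negative part of [g] are
    never both nonzero. *)
Lemma penalty_triple_compl k x t j :
  inm (penalty_triple k x t) 0 j * gminus g j x t = 0 /\
  0 <= inm (penalty_triple k x t) 0 j.
Proof.
rewrite /gminus /= mxE; set s := g _ _ _ _; split; last first.
  by rewrite mulr_ge0// le_max lexx orbT.
case: (lerP s 0) => s0; first by rewrite mulr0 mul0r.
by rewrite (max_idPr _) ?mulr0// oppr_le0 ltW.
Qed.

Lemma admissible_candidate i : admissible (candidate i).
Proof.
case: i => [[a k] M].
pose x (t : lebT R) := xbar t + rat_vec n a.
have mx : measurable_rV D x.
  apply: (measurable_rVD (measurable_xbar nd) (w := fun=> rat_vec n a)).
  exact: measurable_rV_cst.
have [mu mv] := measurable_penalty_triple k mx.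
have [qr|qr] := boolP (enorm (rat_vec n a : 'rV[R]_n) < r); last first.
  rewrite (_ : candidate _ = trivial_triple); first exact: admissible_trivial.
  by apply/funext => t; rewrite /candidate (negbTE qr).
pose b (t : lebT R) := (enorm (eqm (penalty_triple k (x t) t)) <= M%:R) &&
  (enorm (inm (penalty_triple k (x t) t)) <= M%:R).
have mb : measurable_fun D b.
  apply: measurable_and; first exact: measurable_enorm_le mu.
  exact: measurable_enorm_le mv.
have -> : candidate (a, k, M) =
    fun t => if b t then penalty_triple k (x t) t else trivial_triple t.
  by apply/funext => t; rewrite /candidate qr.
have [tx tu tv _ tP] := admissible_trivial.
pose w1 t := penalty_triple k (x t) t; pose w2 := trivial_triple.
split.
- exact: (measurable_proj_if (f := fun w => pt w) (w1 := w1) (w2 := w2)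
    mb mx tx).
- exact: (measurable_proj_if (f := fun w => eqm w) (w1 := w1) (w2 := w2)
    mb mu tu).
- exact: (measurable_proj_if (f := fun w => inm w) (w1 := w1) (w2 := w2)
    mb mv tv).
- exists M%:R => t _; case: ifP => [/andP[uM vM]|_].
    exact: (conj uM vM).
  by rewrite /= !enorm0 ler0n.
- move=> t Dt; case: ifP => _; last exact: tP.
  split; first by rewrite /= addrC addKr.
  by move=> j; exact: penalty_triple_compl.
Qed.

Definition best := running_best defect candidate trivial_triple.

Lemma admissible_best N : admissible (best N).
Proof.
apply: running_best_ind => [|w i wa]; first exact: admissible_trivial.
have ci := admissible_candidate i.
apply: (admissible_if _ ci wa).
exact: measurable_fun_ltr (measurable_defect ci) (measurable_defect wa).
Qed.

(** Pointwise minimality of [xbar t] yields, by the penalty argument, points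
    and weights of small defect; by continuity a rational offset will do. *)
Lemma candidate_small t e : D t -> 0 < e ->
  exists i, defect (candidate i t) t < e.
Proof.
move=> Dt e0.
pose d := e / (3 * n.+1%:R).
have d0 : 0 < d by rewrite divr_gt0// mulr_gt0.
have nd_le : 3 * (n%:R * d) < e.
  have n1 : n%:R < n.+1%:R :> R by rewrite ltr_nat.
  have -> : e = 3 * (n.+1%:R * d).
    by rewrite /d mulrA mulrC divfK// mulf_neq0// pnatr_eq0.
  by rewrite ltr_pM2l// ltr_pM2r.
have cw k : continuous (fun y => defect (penalty_triple k y t) t).
  have cc (a : R) : continuous (fun _ : 'rV[R]_n => a) by exact: cst_continuous.
  apply: continuous_addr; apply: continuous_enorm => l.
    under eq_fun do rewrite !mxE.
    by apply: continuous_subr; [exact: coord_continuous|exact: cc].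
  under eq_fun do rewrite mxE mult_sumE.
  apply: continuous_addr; first exact: cc.
  apply: continuous_addr; apply: continuous_sumr => i; apply: continuous_mulr.
  - under eq_fun do rewrite mxE; apply: continuous_mulr; first exact: cc.
    exact: (carath_h nd i).2 Dt.
  - exact: (carath_dh nd i l).2 Dt.
  - under eq_fun do rewrite mxE; apply: continuous_mulr; first exact: cc.
    by apply: continuous_maxr; [exact: (carath_g nd i).2 Dt|exact: cc].
  - exact: (carath_dg nd i l).2 Dt.
(* Three errors of at most [n d] each: the distance of [x] to [xbar t], the
   change of [grad phi] between the two, and the residual at [x]. *)
have [cphi1 cphi2] := nice_C1 nd Dt.
have /cvgrPdist_lt/(_ _ d0)/nbhs_ballP[d1 d10 d1P] := cphi2 (xbar t).
pose e1 := Num.min (Num.min d1 d) (Num.min r delta / n.+1%:R).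
have e10 : 0 < e1.
  by rewrite !lt_min d10 d0 divr_gt0// lt_min r_gt0.
have e1d1 : e1 <= d1 by rewrite !ge_min lexx.
have e1d : e1 <= d by rewrite !ge_min lexx orbT.
have e1n : n.+1%:R * e1 <= Num.min r delta.
  by rewrite mulrC -ler_pdivlMr// /e1 ge_min lexx orbT.
have ball_e1 y : `|xbar t - y| <= e1 -> enorm (y - xbar t) <= n%:R * e1.
  by move=> ye; rewrite (le_trans (enorm_le_mxnorm _))// distrC ler_wpM2l.
have n1 : n%:R * e1 < Num.min r delta.
  by apply: lt_le_trans e1n; rewrite ltr_pM2r// ltr_nat.
have [|||x [k [xe xst]]] := @approx_stationary _ n p m (phi^~ t)
    (fun l y => h y t 0 l) (fun j y => g y t 0 j) (xbar t) cphi1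
    (fun l y => differentiable_h nd l y Dt)
    (fun j y => differentiable_g nd j y Dt)
    e1 e10.
- by move=> l; rewrite (nice_eq nd Dt) mxE.
- exact: nice_le nd t Dt.
- move=> y /ball_e1 ye hy gy; apply: xbar_min => //.
    apply: (le_trans ye); apply/ltW/(lt_le_trans n1).
    by rewrite ge_min lexx orbT.
  by apply/rowP => l; rewrite hy mxE.
have xr : enorm (x - xbar t) < r.
  apply: le_lt_trans (ball_e1 _ (ltW xe)) _; apply: (lt_le_trans n1).
  by rewrite ge_min lexx.
have dx : defect (penalty_triple k x t) t < e.
  apply: le_lt_trans nd_le.
  have -> : 3 * (n%:R * d) = n%:R * d + n%:R * (d + d) by ring.
  apply: lerD.
    apply: le_trans (ball_e1 _ (ltW xe)) _; exact: ler_wpM2l.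
  apply: le_trans (enorm_le_mxnorm _) _; apply: ler_wpM2l => //.
  apply/mxnorm_leP => [|l]; first by rewrite addr_ge0// ltW.
  rewrite mxE mult_sumE; set G := grad _ _ _ _.
  pose G' := grad (phi^~ t) x 0 l.
  have GG' : `|G - G'| < d.
    apply: le_lt_trans (d1P x _).
      rewrite /G /G'.
      have := coord_le_mxnorm (grad (phi^~ t) (xbar t) - grad (phi^~ t) x) l.
      by rewrite !mxE.
    by rewrite -ball_normE /=; exact: lt_le_trans e1d1.
  set S := (X in G + X).
  have -> : G + S = (G - G') + (G' + S) by ring.
  apply: le_trans (ler_normD _ _) _; apply: lerD; first exact: ltW.
  apply: le_trans e1d; apply: ltW; apply: le_lt_trans (xst l).
  rewrite /G' mxE /S mulrDr !mulr_sumr.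
  rewrite le_eqVlt; apply/orP; left; apply/eqP.
  by congr (`|_ + (_ + _)|); apply: eq_bigr => i _; rewrite !mxE mulrA.
(* One continuous function expresses both strict inequalities to preserve. *)
pose E y := Num.max (defect (penalty_triple k y t) t - e) (enorm (y - xbar t) - r).
have cE : continuous E.
  apply: continuous_maxr; apply: continuous_subr => //; try exact: cst_continuous.
  apply: continuous_enorm => l; under eq_fun do rewrite !mxE.
  by apply: continuous_subr; [exact: coord_continuous|exact: cst_continuous].
have Ex : E x < 0 by rewrite gt_max !subr_lt0 dx.
have [a a0 aP] : exists2 a, 0 < a &
    forall y, enorm (x - y) < a -> `|E x - E y| < - E x.
  by apply: cvg_at_enorm; [exact: cE|rewrite oppr_gt0].
have [q qP] := rat_vec_dense (x - xbar t) a0.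
have : E (xbar t + rat_vec n q) < 0.
  rewrite -(ltrD2r (- E x)) add0r.
  apply: (@le_lt_trans _ _ `|E x - E (xbar t + rat_vec n q)|).
    rewrite distrC; exact: ler_norm.
  by apply: aP; rewrite opprD addrA.
rewrite gt_max !subr_lt0 => /andP[we qr].
pose w1 := penalty_triple k (xbar t + rat_vec n q) t.
pose M := Num.bound (Num.max (enorm (eqm w1)) (enorm (inm w1))).
exists (q, k, M); rewrite /candidate.
rewrite [xbar t + _ - xbar t]addrC addKr in qr.
have : Num.max (enorm (eqm w1)) (enorm (inm w1)) < M%:R.
  by apply: archi_boundP; rewrite le_max enorm_ge0.
rewrite gt_max => /andP[/ltW M1 /ltW M2].
by rewrite -/w1 qr M1 M2.
Qed.

End approximate_multipliers.

(** * The weak outer limit and the theorem *)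

(** The running best triples are the required sequence, with [theta = 0]. Their
    defect dominates both the distance of the point to [xbar] and the error of
    the multiplier sum; it tends to [0] by [candidate_small] and is dominated by
    the defect of the trivial triple, that is by [chat]. *)
Lemma neg_grad_wlimsup (R : realType) (T : R) (n p m : nat)
    (phi : 'rV[R]_n -> R -> R) (h : 'rV[R]_n -> R -> 'rV[R]_p)
    (g : 'rV[R]_n -> R -> 'rV[R]_m) (xbar : R -> 'rV[R]_n) (D : set (lebT R))
    (r delta : R) (chat : R -> R) :
  nice_data T phi h g xbar D -> 0 < r -> 0 < delta ->
  (forall t, D t -> forall y, enorm (y - xbar t) <= delta -> h y t = 0 ->
    (forall j, g y t 0 j <= 0) -> phi (xbar t) t <= phi y t) ->
  lintegrable T chat ->
  (forall t, D t -> enorm (grad (phi^~ t) (xbar t)) <= chat t) ->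
  wlimsup_M T r h g xbar (fun t => - grad (phi^~ t) (xbar t)).
Proof.
move=> nd r0 delta0 xbar_min chat_int gradle.
have fD := nice_full nd; have [mD _ _] := fD.
have mgrad := measurable_grad_phi nd.
pose psi (t : R) := - grad (phi^~ t) (xbar t).
pose w N := best phi h g xbar r N.
pose psis N (t : R) := mult_sum h g (w N t).1.1 t (w N t).1.2 (w N t).2.
have adm N : admissible g xbar D r (w N) by exact: admissible_best nd r0 N.
have mpsis N : measurable_rV D (psis N : lebT R -> _).
  by have [mx mu mv _ _] := adm N; exact: (measurable_mult_sum nd mx mu mv).
have mpsi : measurable_rV D (psi : lebT R -> _).
  by move=> i; under eq_fun do rewrite mxE; exact: (measurable_funN (mgrad i)).
have wle N t : D t -> defect phi h g xbar (w N t) t <= chat t.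
  move=> Dt; apply: le_trans (gradle t Dt).
  rewrite -(defect_trivial phi h g xbar); exact: cost_running_best_start.
have w0 t e : D t -> 0 < e -> exists K, forall N, (K <= N)%N ->
    defect phi h g xbar (w N t) t < e.
  move=> Dt e0; have [i ie] := candidate_small nd r0 delta0 xbar_min Dt e0.
  exists (pickle i).+1 => N iN; apply: le_lt_trans ie.
  exact: cost_running_best_cand.
pose dif N (t : R) := - 1 *: psi t + psis N t.
have difE N t : dif N t = grad (phi^~ t) (xbar t) + psis N t.
  by rewrite /dif /psi scaleN1r opprK.
have dif_le N t : enorm (dif N t) <= defect phi h g xbar (w N t) t.
  by rewrite difE /defect lerDr enorm_ge0.
have mdif N : measurable_rV D (dif N : lebT R -> _).
  exact: (measurable_rVD (measurable_rVZ (- 1) mpsi) (mpsis N)).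
have psiL : L1 T psi.
  move=> i; apply: (lintegrable_le fD (mpsi i) chat_int) => t Dt.
  apply: (le_trans _ (gradle t Dt)); rewrite mxE normrN.
  exact: coord_le_enorm.
have difL N : L1 T (dif N).
  move=> i; apply: (lintegrable_le fD (mdif N i) chat_int) => t Dt.
  by apply: (le_trans (coord_le_enorm _ _)); apply: (le_trans (dif_le N t)); exact: wle.
have psisL N : L1 T (psis N).
  move=> i; have := integrable_scaleD (measurable_itv0 T) 1 (psiL i) (difL N i).
  apply: eq_integrable; first exact: measurable_itv0.
  by move=> t _; rewrite /dif !mxE mul1r mulN1r addNKr.
split; first exact: psiL.
exists (fun N t => (w N t).1.1), (fun _ _ => 0), psis; split.
- move=> N; have [mx _ _ _ xP] := adm N; split.
    split; last by apply: full_ae_on fD _ => t /xP[].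
    by apply: (Linf_close fD (nice_Linf nd) mx (M := r)) => t /xP[/ltW].
  split; last by apply: full_ae_on fD _ => t _ j; rewrite mxE.
  move=> j; apply: (lintegrable_le fD _ chat_int) => [|t Dt]; rewrite ?mxE ?normr0.
    exact: measurable_cst.
  exact: le_trans (enorm_ge0 _) (gradle t Dt).
- apply: full_ae_on fD _ => t Dt; split; last exact: cvg_cst.
  apply/cvgrPdist_lt => e e0; have [K KP] := w0 t e Dt e0.
  exists K => // N /= KN; apply: le_lt_trans (KP N KN).
  rewrite distrC; apply: (le_trans (mxnorm_le_enorm _)).
  by rewrite /defect lerDl enorm_ge0.
- move=> N; have [mx mu mv [M MP] xP] := adm N; split; first exact: psisL.
  exists (fun t => (w N t).1.2), (fun t => (w N t).2); split.
  + by apply: (Linf_full fD mu (M := M)) => t /MP[].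
  + by apply: (Linf_full fD mv (M := M)) => t /MP[].
  + apply: full_ae_on fD _ => t Dt; split; first by [].
    by move=> j; rewrite mxE; exact: (xP t Dt).2.
- apply: weak_L1_of_norm psisL psiL _.
  have mE N : measurable_fun D (fun t : lebT R => enorm (dif N t)).
    exact: measurable_fun_enorm.
  have -> : (fun N => L1norm T (dif N)) =
      fun N => (\int[leb]_(t in D) (enorm (dif N t))%:E)%E.
    apply/funext => N; apply: (integral_full fD).
    apply: (lintegrable_le fD (mE N) chat_int) => t Dt.
    by rewrite ger0_norm ?enorm_ge0//; apply: le_trans (dif_le N t) (wle N t Dt).
  apply: (dominated_to0 mD mE (G := chat)).
  + move=> t Dt; apply/cvgrPdist_lt => e e0; have [K KP] := w0 t e Dt e0.
    exists K => // N /= KN; apply: le_lt_trans (KP N KN).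
    by rewrite sub0r normrN ger0_norm ?enorm_ge0.
  + move=> N t Dt; rewrite enorm_ge0/=; exact: le_trans (dif_le N t) (wle N t Dt).
  + have mchat : measurable_fun D (chat : lebT R -> R).
      apply: (lmeasurable_full fD).
      by have /integrableP[/measurable_EFinP] := chat_int.
    exact: (integrable_full fD mchat).1 chat_int.
Qed.

Theorem theorem3p1 (R : realType) (T : R) (T_gt0 : 0 < T) (n p m : nat)
    (phi : 'rV[R]_n -> R -> R) (h : 'rV[R]_n -> R -> 'rV[R]_p)
    (g : 'rV[R]_n -> R -> 'rV[R]_m) (xbar : R -> 'rV[R]_n) (r : R)
    (xbar_feasible : feasible T h g xbar)
    (r_gt0 : 0 < r) (h1 : H1 T r phi xbar) (h2 : H2 T r h g xbar)
    (regular : AKKT_regular T r h g xbar)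
    (xbar_opt : local_optimal T phi h g xbar) :
  KKT T phi h g xbar.
Proof.
have [Lx feas] := xbar_feasible.
have [aeC1 mphi phi_int [c [chat [c_int chat_int lip grad_bd]]]] := h1.
have [aeC1v mhg _ _] := h2.
have [_ [r' r'0 opt]] := xbar_opt.
have ae1 := ae_onI (ae_onI aeC1 aeC1v) (ae_onI feas (ae_onI lip grad_bd)).
have nice D : full T D -> (forall t, D t -> C1 (phi^~ t) /\ C1v ((hg h g)^~ t)) ->
    (forall t, D t -> h (xbar t) t = 0 /\ forall j, g (xbar t) t 0 j <= 0) ->
    nice_data T phi h g xbar D.
  move=> fD C1D xD; split => // t Dt.
  - exact: (C1D t Dt).1.
  - exact: (C1D t Dt).2.
  - exact: (xD t Dt).1.
  - exact: (xD t Dt).2.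
pose delta := Num.min r r' / 2.
have min0 : 0 < Num.min r r' by rewrite lt_min r_gt0.
have delta0 : 0 < delta by rewrite divr_gt0.
have delta_lt : delta < Num.min r r' by rewrite /delta; lra.
have delta_r : delta <= r by rewrite (le_trans (ltW delta_lt))// ge_min lexx.
have delta_r' : delta < r' by rewrite (lt_le_trans delta_lt)// ge_min lexx orbT.
have [D0 fD0 D0P] := ae_on_full ae1.
have nd0 : nice_data T phi h g xbar D0.
  by apply: nice => // t /D0P[[? ?] [? _]].
have lip0 t : D0 t -> forall x y,
    enorm (x - xbar t) <= r -> enorm (y - xbar t) <= r ->
    `|phi x t - phi y t| <= c t * enorm (x - y).
  by move=> /D0P[_ [_ []]].
have opt_ae := pointwise_optimal nd0 c_int phi_int lip0 delta0 delta_r delta_r' opt.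
have [D fD DP] := ae_on_full (ae_onI ae1 opt_ae).
have nd : nice_data T phi h g xbar D.
  by apply: nice => // t /DP[[[? ?] [? _]] _].
have grad_le t : D t -> enorm (grad (phi^~ t) (xbar t)) <= chat t.
  by move=> /DP[[_ [_ [_ bd]]] _]; apply: bd; rewrite subrr enorm0 ltW.
have xbar_min t : D t -> forall y, enorm (y - xbar t) <= delta -> h y t = 0 ->
    (forall j, g y t 0 j <= 0) -> phi (xbar t) t <= phi y t.
  by move=> /DP[].
have /regular[_ [u [v [uL vL uvP]]]] :=
  neg_grad_wlimsup nd r_gt0 delta0 xbar_min chat_int grad_le.
split; first exact: xbar_feasible.
exists u, v; split; [exact: uL|exact: vL|].
have := ae_onI feas uvP; apply: ae_onS => t [[_ gle] [gradE compl]].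
split; first by rewrite -gradE subrr.
move=> j; have [vg v0] := compl j; split; last exact: v0.
move: vg; rewrite /gminus (max_idPl _) ?oppr_ge0// mulrN mxE => /eqP.
by rewrite oppr_eq0 => /eqP.
Qed.
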